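(* Let $0\le\alpha<1$, $\theta>-\alpha$, and let $\rho_{\alpha,\theta}(s)=P_{\alpha,\theta}(sV_1<1)$ for $s\in\mathbf R$. Then $$(s-1)^\theta\rho_{\alpha,\theta}(s-1)+\int_{s-1}^s (s-t)^{-\alpha}t^\theta\,d\rho_{\alpha,\theta}(t)=0\qquad(s>1),$$ where the integral is a Lebesgue–Stieltjes integral with respect to the (non-increasing) function $\rho_{\alpha,\theta}$.
   Context: $\mathrm{PD}(\alpha,\theta)$ (for $0\le\alpha<1$, $\theta>-\alpha$): let $Y_1,Y_2,\dots$ be independent with $Y_i\sim\mathrm{Beta}(1-\alpha,\theta+i\alpha)$, put $\tilde V_1=Y_1$, $\tilde V_i=(1-Y_1)\cdots(1-Y_{i-1})Y_i$, and let $V_1\ge V_2\ge\cdots$ be the decreasing rearrangement of $(\tilde V_i)$; $\mathrm{PD}(\alpha,\theta)$ is the law of $(V_i)$. $P_{\alpha,\theta}$ denotes a probability under which $(V_i)$ is $\mathrm{PD}(\alpha,\theta)$-distributed. *)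

(* Defs.v *)
From HB Require Import structures.
From mathcomp Require Import all_boot all_order all_algebra.
From mathcomp Require Import all_classical all_reals all_analysis.
Set Implicit Arguments. Unset Strict Implicit. Unset Printing Implicit Defensive.
Import Order.TTheory GRing.Theory Num.Theory.
Import numFieldNormedType.Exports.
Local Open Scope classical_set_scope.
Local Open Scope ring_scope.

Section defs.
Context {R : realType}.

Definition beta_kernel (a b : R) (x : R) : R :=
  powR x (a - 1) * powR (1 - x) (b - 1).

Definition Beta_fun (a b : R) : R :=
  fine (\int[@lebesgue_measure R]_(x in `[0%R, 1%R]) (beta_kernel a b x)%:E)%E.

Definition has_Beta_law d (T : measurableType d) (P : probability T R)
    (X : T -> R) (a b : R) : Prop :=
  forall A : set R, measurable A ->
    P (X @^-1` A) =
    (\int[@lebesgue_measure R]_(x in A `&` `[0%R, 1%R])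
        (beta_kernel a b x / Beta_fun a b)%:E)%E.

Definition mutually_independent d (T : measurableType d) (P : probability T R)
    (X : nat -> T -> R) : Prop :=
  forall (I : seq nat) (B : nat -> set R), uniq I ->
    (forall i, measurable (B i)) ->
    P (\big[setI/setT]_(i <- I) (X i @^-1` B i)) =
    (\prod_(i <- I) P (X i @^-1` B i))%E.

Definition stick (T : Type) (Y : nat -> T -> R) (i : nat) (w : T) : R :=
  Y i w * \prod_(j < i) (1 - Y j w).

(* V_1 = first (largest) entry of the decreasing rearrangement = sup_i tV_i. *)
Definition V1 (T : Type) (Y : nat -> T -> R) (w : T) : R :=
  sup (range (fun i => stick Y i w)).

Definition rho d (T : measurableType d) (P : probability T R)
    (Y : nat -> T -> R) (s : R) : R :=
  fine (P [set w | s * V1 Y w < 1]).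

(* Cumulative (nondecreasing right-continuous) function built from F when F
   is such, otherwise the identity (never used in that case). *)
Definition cumul_of (F : R -> R) : cumulative R R :=
  match pselect (nondecreasing F /\ right_continuous F) with
  | left h => HB.pack_for (cumulative R R) F
                (isCumulative.Build R _ R F (proj1 h) (proj2 h))
  | right _ => idfun
  end.

Definition LS_measure (F : R -> R) := lebesgue_stieltjes_measure (cumul_of F).

(* Lebesgue-Stieltjes integral  \int_D f d(rho)  with respect to a
   non-increasing right-continuous function rho: since d(rho) = - d(-rho),
   it is  - \int_D f d(-rho), the latter w.r.t. the LS measure of -rho. *)
Definition LS_integral_noninc (rho : R -> R) (D : set (measurableTypeR R))
    (f : R -> \bar R) : \bar R :=
  (- \int[LS_measure (fun t => - rho t)%R]_(t in D) f t)%E.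

End defs.

(* Main.v *)
(* Let [V_n] be the largest stick of the sequence broken by [Y_n, Y_(n+1), ...].
   Then [V_n = max(Y_n, (1 - Y_n) V_(n+1))], with [Y_n] independent of [V_(n+1)].
   The first stick is a size-biased pick from all sticks, which gives
     E f(V_n) = E [f(Y_n) / Y_n ; (1 - Y_n) V_(n+1) < Y_n].
   Indeed, unfolding one stick, both sides satisfy the same recursion: for the
   right-hand side this is the symmetry in (x, y) of the joint density
   x^(-alpha) y^(-alpha) (1-x-y)^(theta+(n+2)alpha-1) of two successive sticks.
   If f(v) <= c v, then m steps leave an error at most c E[(1-Y_n)...(1-Y_(n+m-1))],
   which tends to 0. The Stieltjes measure of [- rho] is the law of 1/V_0, so the
   integral in the theorem is the expectation of a function of V_0; writing it in
   size-biased form and substituting 1/x = s - (s-1) z gives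
   (s-1)^theta P((s-1) V_0 < 1). *)
Require Import Defs.
From HB Require Import structures.
From mathcomp Require Import all_boot all_order all_algebra.
From mathcomp Require Import all_classical all_reals all_analysis.
From mathcomp Require Import measurable_realfun ring lra.
Set Implicit Arguments. Unset Strict Implicit. Unset Printing Implicit Defensive.
Import Order.TTheory GRing.Theory Num.Theory.
Import numFieldNormedType.Exports.
Local Open Scope classical_set_scope.
Local Open Scope ring_scope.

(** The identities are therefore proved in [\bar R] for nonnegative functions, and finiteness only
    comes out at the end. The weight [1/x] of the size-biased form is a second obstacle: the error
    after m steps is controlled only for functions with a linear bound [f v <= c * v]. As a function
    of [v = 1/t] the integrand vanishes for [v < 1/s]; its truncation at a level N thus satisfies
    the bound with [c = N * s], and monotone convergence removes the truncation. The error itself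
    vanishes because [E(1 - Y_n) = 1 / (1 + (1 - alpha) / b_n)], where [b_n] grows at most linearly,
    so that the sum of the [(1 - alpha) / b_n] diverges like the harmonic series. The size-biased
    form speaks of [V_1], the theorem of [V_0]: after the substitution, the integrand is the one
    obtained by unfolding one stick in [P((s - 1) V_0 < 1)], so the recursion read backwards closes
    the computation. *)

Section density.
Local Open Scope ereal_scope.
Context d (T : measurableType d) (R : realType) (mu : {measure set T -> \bar R}).
Variable h : T -> R.

(** The two proofs are carried in the term so that the canonical measure structure below can be
    attached to it. *)
Definition density (_ : measurable_fun setT h) (_ : forall x, (0 <= h x)%R)
  (A : set T) : \bar R := \int[mu]_(x in A) (h x)%:E.

Variables (mh : measurable_fun setT h) (h0 : forall x, (0 <= h x)%R).

Let density0 : density mh h0 set0 = 0.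
Proof. by rewrite /density integral_set0. Qed.

Let density_ge0 A : 0 <= density mh h0 A.
Proof. by apply: integral_ge0 => x _; rewrite lee_fin. Qed.

Let density_sigma_additive : semi_sigma_additive (density mh h0).
Proof.
move=> F mF tF mUF; rewrite /density; apply: cvg_toP.
  apply: ereal_nondecreasing_is_cvgn => m n mn.
  by apply: lee_sum_nneg_natr => // k _ _; apply: integral_ge0 => x _; rewrite lee_fin.
rewrite ge0_integral_bigcup//=.
- by apply/measurable_funTS/measurable_EFinP.
- by move=> x _; rewrite lee_fin.
Qed.

HB.instance Definition _ := isMeasure.Build _ _ _ (density mh h0)
  density0 density_ge0 density_sigma_additive.

Import HBNNSimple.

(** Linearity gives the case of simple functions; monotone convergence along [nnsfun_approx] on both
    sides gives the rest. *)
Lemma ge0_integral_density D (f : T -> \bar R) : measurable D ->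
  measurable_fun D f -> (forall x, D x -> 0 <= f x) ->
  \int[density mh h0]_(x in D) f x = \int[mu]_(x in D) (f x * (h x)%:E).
Proof.
move=> mD mf f0.
have mh' E : measurable_fun E (fun x => (h x)%:E).
  exact/measurable_funTS/measurable_EFinP.
pose f_ := nnsfun_approx mD mf.
transitivity (limn (fun n => \int[density mh h0]_(x in D) (f_ n x)%:E)).
  rewrite -monotone_convergence//.
  - apply: eq_integral => y /[!inE] yD; apply/esym/cvg_lim => //.
    exact: cvg_nnsfun_approx.
  - by move=> n; exact/measurable_EFinP/measurable_funTS.
  - by move=> n y _; rewrite lee_fin.
  - by move=> y _ m n mn; rewrite lee_fin; exact/lefP/nd_nnsfun_approx.
have -> : \int[mu]_(x in D) (f x * (h x)%:E) =
    limn (fun n => \int[mu]_(x in D) ((f_ n x)%:E * (h x)%:E)).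
  rewrite -monotone_convergence//.
  - apply: eq_integral => y /[!inE] yD; apply/esym/cvg_lim => //.
    by apply: cvgeZr => //; exact: cvg_nnsfun_approx.
  - move=> n; apply: emeasurable_funM => //.
    by exact/measurable_EFinP/measurable_funTS.
  - by move=> n y _; rewrite mule_ge0// lee_fin.
  - move=> y _ m n mn; rewrite lee_wpmul2r ?lee_fin//.
    exact/lefP/nd_nnsfun_approx.
congr (limn _); apply/funext => n.
under [LHS]eq_integral do rewrite fimfunE -fsumEFin//.
rewrite ge0_integral_fsum//; last 2 first.
- by move=> y; exact/measurable_EFinP/measurable_funM.
- by move=> y x _; rewrite nnfun_muleindic_ge0.
transitivity (\sum_(y \in range (f_ n))
   \int[mu]_(x in D) ((y * \1_(f_ n @^-1` [set y]) x)%:E * (h x)%:E)).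
  apply: eq_fsbigr => r; rewrite inE => -[t _ rE].
  have r0 : (0 <= r)%R by rewrite -rE.
  rewrite integralZl_indic_nnsfun// integral_indic//=.
  under [RHS]eq_integral do rewrite EFinM -muleA.
  rewrite ge0_integralZl//; last first.
  - by move=> x _; rewrite mule_ge0// lee_fin.
  - apply: emeasurable_funM => //.
    by apply/measurable_EFinP; exact: measurable_indic.
  congr (_ * _); rewrite /density setIC integral_mkcondr.
  by apply: eq_integral => x _; rewrite epatch_indic muleC.
rewrite -ge0_integral_fsum//.
- apply: eq_integral => x _.
  rewrite [in RHS]fimfunE -ge0_mule_fsuml//; last first.
    by move=> r; rewrite nnfun_muleindic_ge0.
  by rewrite fsumEFin.
- move=> r; apply: emeasurable_funM => //.
  by exact/measurable_EFinP/measurable_funM.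
- by move=> r x _; rewrite mule_ge0 ?nnfun_muleindic_ge0// lee_fin.
Qed.

End density.

(** * Integration on the line: fundamental theorem of calculus, change of variables,
    measurability *)

Section real_analysis.
Context {R : realType}.
Notation mu := (@lebesgue_measure R).

(* The exhaustion by compact intervals allows an integrable singularity of [f]
   at either end point. *)
Lemma ge0_FTC2_itvoo (f F : R -> R) (a b : R) : a < b ->
  (forall x, a < x < b -> 0 <= f x) ->
  {in `]a, b[, continuous f} ->
  derivable_oo_LRcontinuous F a b ->
  {in `]a, b[, derive1 F =1 f} ->
  (\int[mu]_(x in `]a, b[) (f x)%:E = (F b)%:E - (F a)%:E)%E.
Proof.
move=> ab f0 cf dF F'f.
(* With [n.+3] the margin is below half the length from [n = 0] on, so every [E n] is a
   nondegenerate interval. *)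
pose e n : R := (b - a) / (n.+3)%:R.
have e0 n : 0 < e n by rewrite divr_gt0// subr_gt0.
have e_half n : e n < (b - a) / 2.
  by rewrite ltr_pM2l ?subr_gt0// ltf_pV2 ?posrE// ltr_nat.
have e_cvg : e n @[n --> \oo] --> 0.
  rewrite -[X in _ --> X](mulr0 (b - a)); apply: cvgM; first exact: cvg_cst.
  have := @cvg_harmonic R.
  by rewrite -(cvg_shiftn 2) /=; apply: cvg_trans; apply: near_eq_cvg;
    apply: nearW => n; rewrite /harmonic /= addn2.
pose E n : set R := `[a + e n, b - e n]%classic.
have EU : `]a, b[%classic = \bigcup_n E n.
  apply/seteqP; split => x /=; rewrite in_itv/=.
    move=> /andP[ax xb].
    have : \forall n \near \oo, e n < Num.min (x - a) (b - x).
      by apply: (cvgr_lt 0) => //; rewrite lt_min !subr_gt0 ax xb.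
    move=> [N _ /(_ N (leqnn _))]; rewrite lt_min => /andP[h1 h2].
    by exists N => //; rewrite /E/= in_itv/=; apply/andP; split; lra.
  move=> [n _]; rewrite /E/= in_itv/= => /andP[h1 h2].
  by have := e0 n; move=> ?; apply/andP; split; lra.
have Eab n : E n `<=` `]a, b[ by rewrite EU => x Enx; exists n.
have EFTC n : (\int[mu]_(x in E n) (f x)%:E = (F (b - e n) - F (a + e n))%:E)%E.
  have ? := e0 n; have ? := e_half n.
  have subE x : x \in `[a + e n, b - e n] -> x \in `]a, b[.
    by move=> /Eab.
  rewrite EFinB; apply: continuous_FTC2; first lra.
  - apply: continuous_in_subspaceT => x /set_mem/Eab xab.
    by apply: cf.
  - case: dF => dF _ _.
    have cF x : x \in `]a, b[ -> {for x, continuous F}.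
      by move=> xab; apply/differentiable_continuous/derivable1_diffP; apply: dF.
    split.
    + by move=> x xab; apply: dF; apply: subE; exact: subset_itv_oo_cc.
    + by apply: cvg_at_right_filter; apply: cF; rewrite in_itv/=; apply/andP; split; lra.
    + by apply: cvg_at_left_filter; apply: cF; rewrite in_itv/=; apply/andP; split; lra.
  - by move=> x xab; apply: F'f; apply: subE; exact: subset_itv_oo_cc.
rewrite EU.
have mf : measurable_fun `]a, b[ f.
  apply: open_continuous_measurable_fun => //.
  by move=> x /set_mem; apply: cf.
have cvE : (\int[mu]_(x in E i) (f x)%:E @[i --> \oo] -->
    \int[mu]_(x in \bigcup_i E i) (f x)%:E)%E.
  apply: ge0_nondecreasing_set_cvg_integral => //.
  - move=> m n mn; apply/subsetPset => x; rewrite /E/= !in_itv/= => /andP[h1 h2].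
    have : e n <= e m by rewrite ler_pM2l ?subr_gt0// lef_pV2 ?posrE// ler_nat.
    by move=> ?; apply/andP; split; lra.
  - by move=> n; rewrite /E.
  - by move=> n; apply/measurable_EFinP; apply: measurable_funS mf.
  - by move=> n x /Eab; rewrite /= in_itv/= => h; rewrite lee_fin f0.
apply: (cvg_unique _ cvE) => //.
rewrite /= (_ : (fun i => _) = (fun n => (F (b - e n) - F (a + e n))%:E)); last first.
  by apply/funext => n; rewrite EFTC.
rewrite -EFinB; apply: cvg_EFin; first exact: nearW.
case: dF => _ Fa Fb.
move/cvg_at_rightP : Fa => Fa; move/cvg_at_leftP : Fb => Fb.
apply: cvgB.
- apply: Fb; split => [n|]; first by rewrite ltrBlDr ltrDl.
  by rewrite -[X in _ --> X]subr0; apply: cvgB => //; exact: cvg_cst.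
- apply: Fa; split => [n|]; first by rewrite ltrDl.
  by rewrite -[X in _ --> X]addr0; apply: cvgD => //; exact: cvg_cst.
Qed.

(* The increasing map [phi] transports the measure [phi' dz] on ]a, b[ to the
   Lebesgue measure on ]phi a, phi b[; both are compared on half-lines. *)
Lemma ge0_change_of_variables (phi phi' psi : R -> R) (a b : R)
    (g : R -> \bar R) : a < b ->
  measurable_fun setT phi -> measurable_fun setT phi' ->
  {in `[a, b] &, {mono phi : x y / x < y}} ->
  (forall t, phi a < t < phi b -> a < psi t < b /\ phi (psi t) = t) ->
  (forall z, 0 <= phi' z) ->
  {in `]a, b[, continuous phi'} ->
  {in `[a, b], continuous phi} ->
  (forall z, a < z < b -> is_derive z 1 phi (phi' z)) ->
  measurable_fun setT g -> (forall x, 0 <= g x)%E ->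
  (\int[mu]_(x in `]phi a, phi b[) g x =
   \int[mu]_(z in `]a, b[) (g (phi z) * (phi' z)%:E))%E.
Proof.
move=> ab mphi mphi' monophi psiP phi'0 cphi' cphi dphi mg g0.
have aab : a \in `[a, b] by rewrite in_itv/= lexx ltW.
have bab : b \in `[a, b] by rewrite in_itv/= lexx ltW.
have subab z : a < z < b -> z \in `[a, b].
  by move=> /andP[az zb]; rewrite in_itv/= !ltW.
have FTC u : a < u <= b ->
    (\int[mu]_(z in `]a, u[) (phi' z)%:E = (phi u - phi a)%:E)%E.
  move=> /andP[au ub].
  have abu z : a < z < u -> a < z < b.
    by move=> /andP[-> zu] /=; exact: lt_le_trans ub.
  rewrite EFinB; apply: ge0_FTC2_itvoo => //.
  - by move=> z; rewrite in_itv/= => /abu zab; apply: cphi'; rewrite in_itv.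
  - split.
    + by move=> z; rewrite in_itv/= => /abu /dphi [].
    + by apply: cvg_at_right_filter; exact: cphi.
    + by apply: cvg_at_left_filter; apply: cphi; rewrite in_itv/= ub ltW.
  - by move=> z; rewrite in_itv/= => /abu /dphi [_ <-]; rewrite derive1E.
(* [density] is a measure on the whole line, hence the cut of [phi'] to the open interval. *)
pose h z := phi' z * \1_(`]a, b[%classic) z.
have mh : measurable_fun setT h.
  by apply: measurable_funM => //; exact: measurable_indic.
have h0 z : 0 <= h z by rewrite mulr_ge0.
pose D : set (measurableTypeR R) := `]phi a, phi b[%classic.
have mD : measurable D by exact: measurable_itv.
pose m2 := pushforward (density mu mh h0) (phi : _ -> measurableTypeR R).
have intE (S : set R) : (\int[mu]_(z in S) (h z)%:E =
    \int[mu]_(z in S `&` `]a, b[) (phi' z)%:E)%E.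
  rewrite integral_mkcondr; apply: eq_integral => z _.
  by rewrite epatch_indic EFinM.
have phiDE z : a < z < b -> phi a < phi z < phi b.
  move=> zab; have /andP[az zb] := zab.
  by rewrite !monophi ?az ?zb// subab.
have m12 A : measurable A -> mrestr mu mD A = m2 A.
  pose phi1 := phi : R -> measurableTypeR R.
  have mphi1 : measurable_fun setT phi1 by exact: mphi.
  pose M2 : {measure set (measurableTypeR R) -> \bar R} :=
    measure_function_pushforward__canonical__measure_function_Measure
      (density mu mh h0) mphi1.
  pose M1 : {measure set (measurableTypeR R) -> \bar R} := mrestr mu mD.
  (* The open half-lines form a generating pi-system, and the half-lines up to [n%:R] exhaust the
     line with finite mass. *)
  apply: (@measure_unique _ R (measurableTypeR R) (@RGenInftyO.G R)
     (fun n => `]-oo, n%:R[%classic) _ _ _ _ M1 M2).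
  - exact: RGenInftyO.measurableE.
  - move=> _ _ [x ->] [y ->]; exists (Num.min x y).
    by apply/seteqP; split => z /=; rewrite !in_itv/= lt_min => /andP.
  - by move=> n; exists n%:R.
  - apply/seteqP; split => // x _; exists (Num.bound `|x : R|) => //=.
    by rewrite in_itv/=; apply: le_lt_trans (ler_norm _) (archi_boundP _).
  - move=> _ [t ->]; rewrite /= /pushforward /density /mrestr intE.
    (* Below [phi a] both sets are empty, above [phi b] both are the full interval. In between,
       [psi t] is the point where the half-line cuts []a, b[]; surjectivity of [phi] enters only
       there. *)
    have [tle|tgt] := leP t (phi a).
      rewrite [X in mu X](_ : _ = set0) ?measure0; last first.
        apply/seteqP; split => z //=; rewrite !in_itv/= => -[zt /andP[az _]].
        by have := lt_le_trans (lt_trans az zt) tle; rewrite ltxx.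
      rewrite [X in integral _ X _](_ : _ = set0) ?integral_set0//.
      apply/seteqP; split => z //=; rewrite !in_itv/= => -[zt /phiDE /andP[az _]].
      by have := lt_le_trans (lt_trans az zt) tle; rewrite ltxx.
    have [tge|tlt] := leP (phi b) t.
      rewrite [X in mu X](_ : _ = `]phi a, phi b[%classic); last first.
        apply/seteqP; split => z /=; rewrite !in_itv/=; [by case|move=> zD].
        by split => //; move: zD => /andP[_ zb]; exact: lt_le_trans tge.
      rewrite lebesgue_measure_itv/= lte_fin monophi// ab.
      rewrite [X in integral _ X _](_ : _ = `]a, b[%classic).
        by rewrite FTC// ab lexx.
      apply/seteqP; split => z /=; rewrite !in_itv/=; [by case|move=> zD].
      by split => //; move: (phiDE _ zD) => /andP[_ zb]; exact: lt_le_trans tge.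
    have [] := psiP t; first by rewrite tgt tlt.
    set u := psi t => uab phiu; have /andP[au ub] := uab.
    rewrite [X in mu X](_ : _ = `]phi a, t[%classic); last first.
      apply/seteqP; split => z; rewrite /D/= !in_itv/=.
        by move=> [-> /andP[->]].
      by move=> /andP[az zt]; split => //; rewrite az (lt_trans zt tlt).
    rewrite lebesgue_measure_itv/= lte_fin tgt.
    rewrite [X in integral _ X _](_ : _ = `]a, u[%classic).
      by rewrite FTC ?phiu ?au ?ltW.
    apply/seteqP; split => z /=; rewrite !in_itv/=.
      by move=> [+ zab]; have /andP[-> _] := zab; rewrite -phiu monophi ?subab.
    move=> /andP[az zu]; have zab : a < z < b by rewrite az (lt_trans zu).
    by rewrite zab -phiu monophi ?subab.
  - move=> n; rewrite /= /mrestr.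
    apply: (@le_lt_trans _ _ (mu D)); first exact: measureIr.
    by rewrite /D lebesgue_measure_itv/= lte_fin monophi// ab ltry.
transitivity (\int[m2]_(x in D) g x)%E.
  apply: eq_measure_integral => A mA AD.
  by rewrite -[RHS]/(m2 A) -m12// /mrestr setIidl.
rewrite (@ge0_integral_pushforward _ _ (measurableTypeR R) (measurableTypeR R) R _ mphi
  (density mu mh h0))//; last exact: measurable_funTS.
have mphiD : measurable (phi @^-1` D).
  by rewrite -[X in measurable X]setTI; exact: mphi.
rewrite ge0_integral_density//; last 2 first.
- by apply: measurable_funTS; exact: measurableT_comp.
- by move=> z _; exact: g0.
rewrite integral_mkcond [RHS]integral_mkcond; apply: eq_integral => z _.
rewrite /patch /h indicE.
have [zab|zab] := boolP (z \in `]a, b[%classic).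
  rewrite ifT ?mulr1//; apply/mem_set; rewrite /D/= in_itv/=; apply: phiDE.
  by move: zab => /set_mem/=; rewrite in_itv.
by rewrite mulr0 mule0 if_same.
Qed.

Lemma measurable_fun_powR d (T : measurableType d) (f : T -> R) (p : R) :
  measurable_fun setT f -> measurable_fun setT (fun x => powR (f x) p).
Proof. by move=> mf; exact: (measurableT_comp (@measurable_powR R p) mf). Qed.

Lemma measurable_invr : measurable_fun setT (fun x : R => x^-1).
Proof.
rewrite (_ : (fun x : R => x^-1) = fun x =>
  if 0 < x then powR x (-1) else (if x < 0 then - powR (- x) (-1) else 0)).
  apply: measurable_fun_ifT; first exact: measurable_fun_ltr.
    exact: measurable_powR.
  apply: measurable_fun_ifT => //; first exact: measurable_fun_ltr.
  by apply: measurable_funN; apply: measurable_fun_powR; exact: measurable_funN.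
apply/funext => x; case: (ltgtP 0 x) => [x0|x0|<-].
- by rewrite powR_inv1 ?ltW.
- by rewrite powR_inv1 ?oppr_ge0 ?ltW// invrN opprK.
- by rewrite invr0.
Qed.

Lemma measurable_fun_inv d (T : measurableType d) (f : T -> R) :
  measurable_fun setT f -> measurable_fun setT (fun x => (f x)^-1).
Proof. by move=> mf; exact: (measurableT_comp measurable_invr mf). Qed.

Lemma measurable_fun_natb d (T : measurableType d) (b : T -> bool) :
  measurable_fun setT b -> measurable_fun setT (fun x => (b x)%:R : R).
Proof.
move=> mb; rewrite (_ : (fun x => _) = (fun x => if b x then 1 else 0)).
  exact: measurable_fun_ifT.
by apply/funext => x; case: (b x).
Qed.

End real_analysis.

(** * Integrals of powers and of Beta kernels *)

Section power_integrals.
Context {R : realType}.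
Notation mu := (@lebesgue_measure R).

Lemma integral_support (D : set R) (g : R -> \bar R) :
  (forall x, ~ D x -> g x = 0)%E ->
  (\int[mu]_x g x = \int[mu]_(x in D) g x)%E.
Proof.
move=> g0; rewrite [RHS]integral_mkcond; apply: eq_integral => x _.
by rewrite /patch; case: ifPn => // /negP xD; rewrite g0// => /mem_set.
Qed.

Lemma continuous_powR_gt0 (p t : R) : 0 < t -> {for t, continuous (fun x : R => x `^ p)}.
Proof.
move=> t0; apply/differentiable_continuous/derivable1_diffP.
by have [] := @is_derive1_powR _ p t t0.
Qed.

Lemma integral_powR0 (a x : R) : 0 < a -> 0 < x ->
  (\int[mu]_(t in `]0%R, x[) (a * t `^ (a - 1))%:E = (x `^ a)%:E)%E.
Proof.
move=> a0 x0.
rewrite (@ge0_FTC2_itvoo _ _ (fun t => t `^ a))//.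
- by rewrite powR0 ?sube0 ?gt_eqF.
- by move=> t _; rewrite mulr_ge0 ?powR_ge0 ?ltW.
- move=> t; rewrite in_itv/= => /andP[t0 _].
  apply: cvgM; first exact: cvg_cst.
  exact: continuous_powR_gt0.
- split.
  + by move=> t; rewrite in_itv/= => /andP[t0 _]; have [] := @is_derive1_powR _ a t t0.
  + by rewrite powR0 ?gt_eqF//; exact: powR_cvg0.
  + by apply: cvg_at_left_filter; exact: continuous_powR_gt0.
- move=> t; rewrite in_itv/= => /andP[t0 _].
  by have [_ <-] := @is_derive1_powR _ a t t0; rewrite derive1E.
Qed.

Lemma is_derive_onem_powR (b t : R) : t < 1 ->
  is_derive t 1 (fun t => - (1 - t) `^ b) (b * (1 - t) `^ (b - 1)).
Proof.
move=> t1; have t0 : 0 < 1 - t by rewrite subr_gt0.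
have h : is_derive t 1 (fun t => 1 - t) (-1).
  have : is_derive t (1 : R) (cst 1 - id) (0 - 1 : R) by exact: is_deriveB.
  by rewrite sub0r.
have : is_derive t 1 (- ((fun x : R => x `^ b) \o (fun t => 1 - t)))
    (- ((b * (1 - t) `^ (b - 1)) * -1)).
  by apply: is_deriveN; apply: is_derive1_comp; exact: is_derive1_powR.
by rewrite mulrN1 opprK.
Qed.

Lemma continuous_onem_powR (p t : R) : t < 1 ->
  {for t, continuous (fun t : R => (1 - t) `^ p)}.
Proof.
move=> t1; apply: (@continuous_comp _ _ _ (fun t : R => 1 - t) (fun x : R => x `^ p)).
  by apply: cvgB; [exact: cvg_cst|exact: cvg_id].
by apply: continuous_powR_gt0; rewrite subr_gt0.
Qed.

Lemma integral_onem_powR (b x : R) : 0 < b -> x < 1 ->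
  (\int[mu]_(t in `]x, 1%R[) (b * (1 - t) `^ (b - 1))%:E = ((1 - x) `^ b)%:E)%E.
Proof.
move=> b0 x1.
rewrite (@ge0_FTC2_itvoo _ _ (fun t => - (1 - t) `^ b))//.
- by rewrite subrr powR0 ?gt_eqF// oppr0 sub0e -EFinN opprK.
- by move=> t _; rewrite mulr_ge0 ?powR_ge0 ?ltW.
- move=> t; rewrite in_itv/= => /andP[_ t1].
  apply: cvgM; first exact: cvg_cst.
  exact: continuous_onem_powR.
- split.
  + by move=> t; rewrite in_itv/= => /andP[_ t1]; have [] := is_derive_onem_powR b t1.
  + by apply: cvg_at_right_filter; apply: cvgN; exact: continuous_onem_powR.
  + rewrite subrr powR0 ?gt_eqF//; apply: cvgN.
    apply/cvg_at_leftP => u [u1 cu].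
    have /cvg_at_rightP := @powR_cvg0 R b b0.
    apply; split; first by move=> n; rewrite subr_gt0.
    by rewrite -[X in _ --> X](subrr 1); apply: cvgB => //; exact: cvg_cst.
- move=> t; rewrite in_itv/= => /andP[_ t1].
  by have [_ <-] := is_derive_onem_powR b t1; rewrite derive1E.
Qed.

(** The Beta kernel cut to the open unit interval, so that all integrals can run over the whole
    line; without the cut, [powR] at a negative base need not vanish. *)
Definition bker (a b x : R) : R :=
  (0 < x)%R%:R * (x < 1)%R%:R * (x `^ (a - 1) * (1 - x) `^ (b - 1)).

Lemma bker_ge0 a b x : 0 <= bker a b x.
Proof. by rewrite !mulr_ge0 ?powR_ge0. Qed.

Lemma bker_out a b x : ~ (0 < x < 1) -> bker a b x = 0.
Proof.
by move=> /negP; rewrite negb_and => /orP[]/negbTE h; rewrite /bker h ?mulr0 !mul0r.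
Qed.

Lemma bker_in a b x : 0 < x < 1 -> bker a b x = x `^ (a - 1) * (1 - x) `^ (b - 1).
Proof. by move=> /andP[x0 x1]; rewrite /bker x0 x1 !mul1r. Qed.

Lemma measurable_bker a b : measurable_fun setT (bker a b).
Proof.
apply: measurable_funM; first apply: measurable_funM.
- by apply: measurable_fun_natb; exact: measurable_fun_ltr.
- by apply: measurable_fun_natb; exact: measurable_fun_ltr.
- apply: measurable_funM; first exact: measurable_fun_powR.
  by apply: measurable_fun_powR; exact: measurable_funB.
Qed.

(* Both sides are the integral of a x^(a-1) b (1-t)^(b-1) over 0 < x < t < 1. *)
Lemma bker_parts (a b : R) : 0 < a -> 0 < b ->
  (a%:E * \int[mu]_x (bker a (b + 1) x)%:E =
   b%:E * \int[mu]_x (bker (a + 1) b x)%:E)%E.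
Proof.
move=> a0 b0.
pose G (p : R * R) : R := (0 < p.1)%R%:R * (p.1 < p.2)%R%:R * (p.2 < 1)%R%:R *
  ((a * p.1 `^ (a - 1)) * (b * (1 - p.2) `^ (b - 1))).
have mG : measurable_fun setT (EFin \o G).
  apply/measurable_EFinP; apply: measurable_funM.
    apply: measurable_funM; first apply: measurable_funM.
    - by apply: measurable_fun_natb; exact: measurable_fun_ltr.
    - by apply: measurable_fun_natb; exact: measurable_fun_ltr.
    - by apply: measurable_fun_natb; exact: measurable_fun_ltr.
  apply: measurable_funM; apply: measurable_funM => //.
    exact: measurable_fun_powR.
  by apply: measurable_fun_powR; exact: measurable_funB.
have G0 p : (0 <= (EFin \o G) p)%E.
  by rewrite lee_fin /G !mulr_ge0 ?powR_ge0 ?ler0n ?(ltW a0) ?(ltW b0).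
have := @fubini_tonelli _ _ (measurableTypeR R) (measurableTypeR R) R mu mu _ mG G0.
have Zl c u v : 0 <= c -> (c%:E * \int[mu]_x (bker u v x)%:E =
    \int[mu]_x (c%:E * (bker u v x)%:E))%E.
  move=> c0; rewrite ge0_integralZl_EFin//.
  - by move=> x _; rewrite lee_fin bker_ge0.
  - by apply/measurable_EFinP; exact: measurable_bker.
rewrite (Zl _ _ _ (ltW a0)) (Zl _ _ _ (ltW b0)) => GE.
transitivity (\int[mu]_x \int[mu]_y (EFin \o G) (x, y))%E; last rewrite GE.
all: apply: eq_integral => x _; clear GE.
- apply/esym; have [x01|x01] := pselect (0 < x < 1); last first.
    rewrite bker_out// mule0 integral0_eq// => t _; rewrite /= /G/=.
    have [x0|x0] := boolP (0 < x); last by rewrite !mul0r.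
    have [xt|xt] := boolP (x < t); last by rewrite mulr0 !mul0r.
    have [t1|t1] := boolP (t < 1); last by rewrite mulr0 !mul0r.
    by exfalso; apply: x01; rewrite x0 (lt_trans xt t1).
  have /andP[x0 x1] := x01.
  rewrite (@integral_support `]x, 1%R[%classic); last first.
    move=> t /negP; rewrite /= in_itv/= negb_and => /orP[]/negbTE h.
      by rewrite /G/= h mulr0 !mul0r.
    by rewrite /G/= h mulr0 !mul0r.
  transitivity (\int[mu]_(t in `]x, 1%R[) ((a * x `^ (a - 1))%:E *
      (b * (1 - t) `^ (b - 1))%:E))%E.
    apply: eq_integral => t; rewrite inE/= in_itv/= => /andP[xt t1].
    by rewrite /G/= x0 xt t1 !mul1r.
  rewrite ge0_integralZl_EFin//; last 3 first.
  + by move=> t _; rewrite lee_fin mulr_ge0 ?powR_ge0 ?ltW.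
  + apply/measurable_EFinP/measurable_funTS/measurable_funM => //.
    by apply: measurable_fun_powR; exact: measurable_funB.
  + by rewrite mulr_ge0 ?powR_ge0 ?ltW.
  rewrite integral_onem_powR// -EFinM bker_in// -EFinM.
  by rewrite (_ : b + 1 - 1 = b) ?mulrA//; lra.
- have [x01|x01] := pselect (0 < x < 1); last first.
    rewrite bker_out// mule0 integral0_eq// => t _; rewrite /= /G/=.
    have [x0|x0] := boolP (0 < t); last by rewrite !mul0r.
    have [xt|xt] := boolP (t < x); last by rewrite mulr0 !mul0r.
    have [t1|t1] := boolP (x < 1); last by rewrite mulr0 !mul0r.
    by exfalso; apply: x01; rewrite (lt_trans x0 xt).
  have /andP[x0 x1] := x01.
  rewrite (@integral_support `]0%R, x[%classic); last first.
    move=> t /negP; rewrite /= in_itv/= negb_and => /orP[]/negbTE h.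
      by rewrite /G/= h !mul0r.
    by rewrite /G/= h mulr0 !mul0r.
  transitivity (\int[mu]_(t in `]0%R, x[) ((b * (1 - x) `^ (b - 1))%:E *
      (a * t `^ (a - 1))%:E))%E.
    apply: eq_integral => t; rewrite inE/= in_itv/= => /andP[xt t1].
    by rewrite /G/= x1 xt t1 !mul1r -EFinM mulrC.
  rewrite ge0_integralZl_EFin//; last 3 first.
  + by move=> t _; rewrite lee_fin mulr_ge0 ?powR_ge0 ?ltW.
  + by apply/measurable_EFinP/measurable_funTS/measurable_funM.
  + by rewrite mulr_ge0 ?powR_ge0 ?ltW.
  rewrite integral_powR0// -EFinM bker_in// -EFinM.
  by rewrite (_ : a + 1 - 1 = a) ?(mulrC (x `^ a)) ?mulrA//; lra.
Qed.

Lemma bker_onem a b x : (1 - x) * bker a b x = bker a (b + 1) x.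
Proof.
have [x01|x01] := pselect (0 < x < 1); last by rewrite !bker_out ?mulr0.
rewrite !bker_in// (_ : b + 1 - 1 = 1 + (b - 1)); last lra.
have x1 : 0 < 1 - x by move: x01 => /andP[_]; lra.
by rewrite [_ `^ (1 + _)]powRD ?(gt_eqF x1) ?implybT// powRr1 ?ltW// mulrCA.
Qed.

Lemma bker_mul a b x : x * bker a b x = bker (a + 1) b x.
Proof.
have [x01|x01] := pselect (0 < x < 1); last by rewrite !bker_out ?mulr0.
rewrite !bker_in// (_ : a + 1 - 1 = 1 + (a - 1)); last lra.
have x0 : 0 < x by move: x01 => /andP[].
by rewrite [_ `^ (1 + _)]powRD ?(gt_eqF x0) ?implybT// powRr1 ?ltW// mulrA.
Qed.

(** The mean of [1 - X] for a Beta variable, without the value of the Beta function: the integrals u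
    of [(1 - x) * bker a b x] and v of [x * bker a b x] satisfy [u + v = c] and, by [bker_parts],
    [a * u = b * v]. *)
Lemma integral_bker_onem (a b c : R) : 0 < a -> 0 < b ->
  (\int[mu]_x (bker a b x)%:E = c%:E)%E ->
  (\int[mu]_x ((1 - x) * bker a b x)%:E = (b / (a + b) * c)%:E)%E.
Proof.
move=> a0 b0 cE.
have mk u v : measurable_fun [set: measurableTypeR R] (fun x => (bker u v x)%:E).
  by apply/measurable_EFinP; exact: measurable_bker.
have k0 u v x : (0 <= (bker u v x)%:E)%E by rewrite lee_fin bker_ge0.
under eq_integral do rewrite bker_onem.
have h1 : (\int[mu]_x (bker a (b + 1) x)%:E + \int[mu]_x (bker (a + 1) b x)%:E =
    c%:E)%E.
  rewrite -ge0_integralD// -cE; apply: eq_integral => x _.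
  rewrite -EFinD -bker_onem -bker_mul; congr _%:E; ring.
have h2 := bker_parts a0 b0.
have : (0 <= \int[mu]_x (bker a (b + 1) x)%:E)%E by exact: integral_ge0.
have : (0 <= \int[mu]_x (bker (a + 1) b x)%:E)%E by exact: integral_ge0.
move: h1 h2.
(* Both integrals are nonnegative with the finite sum [c], so only the finite case survives. *)
case: (\int[mu]_x (bker a (b + 1) x)%:E)%E => [u||] //;
case: (\int[mu]_x (bker (a + 1) b x)%:E)%E => [v||] //.
rewrite -!EFinM -EFinD => -[h1] [h2] _ _; congr _%:E.
have ab : a + b != 0 by rewrite gt_eqF// addr_gt0.
apply: (mulfI ab); rewrite -h1 mulrA mulrCA divff// mulr1.
by rewrite mulrDl h2; ring.
Qed.

(** Used with [c = 1 - x]: it passes from the second stick measured relative to what the first one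
    left over, to its absolute length. *)
Lemma integral_scale01 (g : R -> R) (c : R) : 0 < c ->
  measurable_fun setT g -> (forall x, 0 <= g x) ->
  (forall x, ~ (0 < x < 1) -> g x = 0) ->
  (\int[mu]_x (g x)%:E = \int[mu]_x (g (x / c) / c)%:E)%E.
Proof.
move=> c0 mg g0 gout.
rewrite (@integral_support `]0%R, 1%R[%classic); last first.
  by move=> x; rewrite /= in_itv/= => h; rewrite gout.
have c1 : c / c = 1 by rewrite divff// gt_eqF.
have := @ge0_change_of_variables R (fun x => x / c) (cst c^-1) (fun x => x * c)
  0 c (EFin \o g) c0.
rewrite mul0r c1 => cov.
transitivity (\int[mu]_(z in `]0%R, c[) (g (z / c) / c)%:E)%E; last first.
  rewrite [RHS](@integral_support `]0%R, c[%classic)//.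
  move=> x; rewrite /= in_itv/= => h; rewrite gout ?mul0r//.
  by rewrite ltr_pdivlMr// mul0r ltr_pdivrMr// mul1r.
apply: cov.
- exact: measurable_funM.
- exact: measurable_cst.
- by move=> x y _ _; rewrite ltr_pM2r ?invr_gt0.
- move=> t /andP[t0 t1]; rewrite mulr_gt0//= gtr_pMl// t1.
  by split => //; rewrite mulfK// gt_eqF.
- by move=> z; rewrite invr_ge0 ltW.
- by move=> x _; exact: cvg_cst.
- by move=> x _; apply: cvgM; [exact: cvg_id|exact: cvg_cst].
- move=> z _; have : is_derive z (1:R) (c^-1 \*: id) (c^-1 *: (1:R)).
    exact: is_deriveZ.
  rewrite /GRing.scale/= mulr1; congr (is_derive _ _ _ _).
  by apply/funext => x /=; rewrite /GRing.scale/= mulrC.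
- exact/measurable_EFinP.
- by move=> x; rewrite lee_fin.
Qed.

End power_integrals.

Ltac mfun := repeat first
  [ exact: measurable_cst | exact: measurable_id
  | exact: measurable_fst | exact: measurable_snd
  | apply: measurable_fun_natb
  | apply: measurable_fun_ltr | apply: measurable_fun_ler
  | apply: measurable_funM | apply: measurable_funB
  | apply: measurable_maxr | apply: measurable_fun_powR
  | apply: measurable_fun_inv ].

(** * The probabilities that [p * V < q] *)

Section sub_distribution.
Context {R : realType} (nu : probability R R).

(** Two parameters instead of the quotient [q / p]: no sign condition is needed to form it, and
    [ltprob_scale] absorbs the common factors produced by rescaling. *)
Definition ltprob (p q : R) : R := fine (nu [set v | p * v < q]).

Let mset (p q : R) : measurable [set v : R | p * v < q].
Proof.
rewrite -[X in measurable X]setTI.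
have : measurable_fun setT (fun v : R => p * v < q) by mfun.
by move=> /(_ measurableT [set true] I).
Qed.

Lemma ltprob_ge0 p q : 0 <= ltprob p q.
Proof. by rewrite fine_ge0. Qed.

Lemma ltprob_le1 p q : ltprob p q <= 1.
Proof.
rewrite -lee_fin fineK ?fin_num_measure//.
by apply: probability_le1; exact: mset.
Qed.

Lemma ltprobE p q : (ltprob p q)%:E = (\int[nu]_v ((p * v < q)%R%:R)%:E)%E.
Proof.
rewrite fineK ?fin_num_measure//.
rewrite -[X in nu X]setIT -integral_indic//.
apply: eq_integral => v _; rewrite indicE; congr (_%:R)%:E; congr nat_of_bool.
by apply/idP/idP; rewrite inE.
Qed.

Lemma ltprob_scale p q c : 0 < c -> ltprob (p / c) (q / c) = ltprob p q.
Proof.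
move=> c0; rewrite /ltprob; congr (fine (nu _)); apply/seteqP.
by split => v /=; rewrite mulrAC ltr_pM2r ?invr_gt0.
Qed.

(** As the partial integral of a jointly measurable indicator, it is measurable by Tonelli. *)
Lemma measurable_ltprob d (T : measurableType d) (f g : T -> R) :
  measurable_fun setT f -> measurable_fun setT g ->
  measurable_fun setT (fun x => ltprob (f x) (g x)).
Proof.
move=> mf mg; apply/measurable_EFinP.
rewrite (_ : _ \o _ = fun x => (\int[nu]_v ((f x * v < g x)%R%:R)%:E)%E); last first.
  by apply/funext => x; rewrite /= ltprobE.
apply: (@measurable_fun_fubini_tonelli_F _ _ T R R nu
  (fun z : T * R => ((f z.1 * z.2 < g z.1)%R%:R)%:E)).
- apply/measurable_EFinP; apply: measurable_fun_natb; apply: measurable_fun_ltr.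
    apply: measurable_funM; last exact: measurable_snd.
    by apply: (measurableT_comp mf); exact: measurable_fst.
  by apply: (measurableT_comp mg); exact: measurable_fst.
- by move=> z; rewrite lee_fin.
Qed.

End sub_distribution.

(** * Size-biased sampling for an abstract sequence of laws [nu n] linked by the recursion *)

Section size_bias.
Context {R : realType}.
Notation mu := (@lebesgue_measure R).
Variables (al : R) (b : nat -> R) (C : nat -> R) (nu : nat -> probability R R).
Hypothesis al1 : al < 1.
Hypothesis b_gt0 : forall n, 0 < b n.
Hypothesis bS : forall n, b n.+1 = b n + al.
Hypothesis C_gt0 : forall n, 0 < C n.

Definition stick_density n x : R := C n * bker (1 - al) (b n) x.
Local Notation k := stick_density.

Hypothesis k1 : forall n, (\int[mu]_x (k n x)%:E = 1)%E.
Hypothesis nu01 : forall n, nu n (~` `[0, 1]%classic) = 0%E.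
Hypothesis nu_rec : forall n (f : R -> R), measurable_fun setT f ->
  (forall v, 0 <= f v) ->
  (\int[nu n]_v (f v)%:E =
   \int[mu]_x ((k n x)%:E *
     \int[nu n.+1]_v (f (Num.max x ((1 - x) * v)%R))%:E))%E.

Lemma stick_density_ge0 n x : 0 <= k n x.
Proof. by rewrite mulr_ge0 ?bker_ge0 ?ltW. Qed.

Lemma stick_density_out n x : ~ (0 < x < 1) -> k n x = 0.
Proof. by move=> h; rewrite /k bker_out ?mulr0. Qed.

Lemma measurable_stick_density d (T : measurableType d) n (f : T -> R) :
  measurable_fun setT f -> measurable_fun setT (fun x => k n (f x)).
Proof.
move=> mf; apply: measurable_funM => //.
exact: (measurableT_comp (measurable_bker _ _) mf).
Qed.

Local Notation M n := (ltprob (nu n)).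
Let k0 := stick_density_ge0.
Let kout := stick_density_out.
Let mk := measurable_stick_density.
Let M0 n := ltprob_ge0 (nu n).

(* The two sides of the size-biasing identity: [E f(V_n)] and
   [E [f(Y_n) / Y_n ; (1 - Y_n) V_(n+1) < Y_n]]. *)
Definition lawI n (f : R -> R) : \bar R := (\int[nu n]_v (f v)%:E)%E.
Definition biasI n (f : R -> R) : \bar R :=
  (\int[mu]_x (k n x * f x / x * M n.+1 (1 - x) x)%:E)%E.
(** The share of [f (V_n)] on the event that a first stick of length [x] does not strictly exceed
    all later ones. Ties are counted here, which complements the strict inequality in [ltprob]; the
    other share is [A]. *)
Definition rest (f : R -> R) (x v : R) : R :=
  f ((1 - x) * v) * (x <= (1 - x) * v)%R%:R.
Local Notation L := lawI.
Local Notation S := biasI.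
Let A n (f : R -> R) : \bar R :=
  (\int[mu]_x (k n x * (f x * M n.+1 (1 - x) x))%:E)%E.

Lemma rest_ge0 (f : R -> R) x v : (forall v, 0 <= f v) -> 0 <= rest f x v.
Proof. by move=> f0; rewrite mulr_ge0. Qed.

Lemma measurable_rest2 (f : R -> R) : measurable_fun setT f ->
  measurable_fun setT (fun z : R * R => rest f z.1 z.2).
Proof.
move=> mf; apply: measurable_funM; last by mfun.
by apply: (measurableT_comp mf); mfun.
Qed.

Lemma measurable_rest (f : R -> R) x : measurable_fun setT f -> measurable_fun setT (rest f x).
Proof.
move=> mf; apply: measurable_funM; last by mfun.
by apply: (measurableT_comp mf); mfun.
Qed.

Lemma lawI_ge0 n (f : R -> R) : (forall v, 0 <= f v) -> (0 <= L n f)%E.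
Proof. by move=> f0; apply: integral_ge0 => v _; rewrite lee_fin. Qed.

Let S_int_ge0 n (f : R -> R) x : (forall v, 0 <= f v) ->
  0 <= k n x * f x / x * M n.+1 (1 - x) x.
Proof.
move=> f0; have [/andP[x0 _]|x01] := pselect (0 < x < 1).
  apply: mulr_ge0 (M0 _ _ _); apply: mulr_ge0; last by rewrite invr_ge0 ltW.
  exact: mulr_ge0.
by rewrite kout// !mul0r.
Qed.

Lemma biasI_ge0 n (f : R -> R) : (forall v, 0 <= f v) -> (0 <= S n f)%E.
Proof. by move=> f0; apply: integral_ge0 => v _; rewrite lee_fin S_int_ge0. Qed.

Lemma measurable_lawI_rest n (f : R -> R) : measurable_fun setT f -> (forall v, 0 <= f v) ->
  measurable_fun setT (fun x : R => L n (rest f x)).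
Proof.
move=> mf f0.
apply: (@measurable_fun_fubini_tonelli_F _ _ R R R (nu n)
  (fun z : R * R => (rest f z.1 z.2)%:E)).
- by apply/measurable_EFinP; exact: measurable_rest2.
- by move=> z; rewrite lee_fin rest_ge0.
Qed.

Lemma measurable_biasI_rest n (f : R -> R) : measurable_fun setT f -> (forall v, 0 <= f v) ->
  measurable_fun setT (fun x : R => S n (rest f x)).
Proof.
move=> mf f0.
apply: (@measurable_fun_fubini_tonelli_F _ _ R (measurableTypeR R) R mu
  (fun z : R * R => (k n z.2 * rest f z.1 z.2 / z.2 * M n.+1 (1 - z.2) z.2)%:E)).
- apply/measurable_EFinP; apply: measurable_funM; last first.
    by apply: measurable_ltprob; mfun.
  apply: measurable_funM; last by mfun.
  by apply: measurable_funM; [apply: mk; mfun|exact: measurable_rest2].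
- by move=> z; rewrite lee_fin; apply: S_int_ge0 => v; rewrite rest_ge0.
Qed.

Lemma lawI_rec n (f : R -> R) : measurable_fun setT f -> (forall v, 0 <= f v) ->
  L n f = (A n f + \int[mu]_x ((k n x)%:E * L n.+1 (rest f x)))%E.
Proof.
move=> mf f0; rewrite /L nu_rec// /A -ge0_integralD//; last 4 first.
- by move=> x _; rewrite lee_fin; apply: mulr_ge0 (k0 _ _) _; exact: mulr_ge0 (f0 _) (M0 _ _ _).
- apply/measurable_EFinP; apply: measurable_funM; first by apply: mk; mfun.
  by apply: measurable_funM => //; apply: measurable_ltprob; mfun.
- by move=> x _; rewrite mule_ge0 ?lee_fin ?k0// lawI_ge0// => v; rewrite rest_ge0.
- apply: emeasurable_funM; first by apply/measurable_EFinP; apply: mk; mfun.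
  exact: measurable_lawI_rest.
apply: eq_integral => x _.
rewrite [X in (X + _)%E]EFinM -ge0_muleDr; last 2 first.
- by rewrite lee_fin; exact: mulr_ge0 (f0 _) (M0 _ _ _).
- by apply: lawI_ge0 => v; rewrite rest_ge0.
congr (_ * _)%E; rewrite EFinM ltprobE -ge0_integralZl_EFin//; last first.
  by apply/measurable_EFinP; mfun.
rewrite -ge0_integralD//; last 4 first.
- by move=> v _; rewrite mule_ge0// lee_fin.
- by apply/measurable_EFinP; apply: measurable_funM => //; mfun.
- by move=> v _; rewrite lee_fin rest_ge0.
- by apply/measurable_EFinP; exact: measurable_rest.
apply: eq_integral => v _; rewrite -EFinM -EFinD /rest; congr _%:E.
by case: (leP x ((1 - x) * v)) => h; rewrite ?mulr1 ?mulr0 ?addr0 ?add0r.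
Qed.

(** A maximum lies below [q] exactly when both terms do, and [0 <= p] lets [p] enter the maximum. It
    serves twice: to unfold a second stick in [claim2], and backwards at the end to recover the law
    of [V_0]. *)
Lemma ltprob_rec n (p q : R) : 0 <= p -> ((M n p q)%:E =
  \int[mu]_y (k n y * (p * y < q)%R%:R * M n.+1 (p * (1 - y)) q)%:E)%E.
Proof.
move=> p0; rewrite ltprobE nu_rec//; last by mfun.
apply: eq_integral => y _; rewrite -mulrA [RHS]EFinM; congr (_ * _)%E.
rewrite [RHS]EFinM ltprobE -ge0_integralZl_EFin//; last by apply/measurable_EFinP; mfun.
apply: eq_integral => v _; rewrite -EFinM; congr _%:E.
rewrite maxr_pMr// gt_max -mulrA.
by case: (_ < _); case: (_ < _); rewrite ?mulr0 ?mulr1.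
Qed.

(** With [y] the absolute length of the second stick, this is the joint density of two successive
    sticks without the Jacobian [1 / (1 - x)]. That factor would destroy the symmetry; [claim1] and
    [claim2] each supply a [1 - x] that cancels it. *)
Let K n x y := k n x * k n.+1 (y / (1 - x)).

Let powRV (c p : R) : 0 < c -> c^-1 `^ p = c `^ (- p).
Proof. by move=> c0; rewrite -powR_inv1 ?ltW// -powRrM mulN1r. Qed.

Let KE n x y : K n x y = C n * C n.+1 *
  ((0 < x)%R%:R * (0 < y)%R%:R * (x + y < 1)%R%:R) *
  (x `^ (- al) * y `^ (- al) * (1 - x - y) `^ (b n.+1 - 1)).
Proof.
rewrite /K; have [x0|x0] := boolP (0 < x); last first.
  rewrite kout; first by rewrite !(mul0r, mulr0).
  by apply/negP; rewrite negb_and x0.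
have [x1|x1] := boolP (x < 1); last first.
  rewrite kout; last by apply/negP; rewrite negb_and x1 orbT.
  have [y0|y0] := boolP (0 < y); last by rewrite !(mul0r, mulr0).
  have [xy1|xy1] := boolP (x + y < 1); last by rewrite !(mul0r, mulr0).
  by exfalso; move: x1; rewrite -leNgt; lra.
have [y0|y0] := boolP (0 < y); last first.
  rewrite (@kout n.+1); first by rewrite !(mul0r, mulr0).
  by apply/negP; rewrite negb_and pmulr_lgt0 ?y0// invr_gt0 subr_gt0.
have [xy1|xy1] := boolP (x + y < 1); last first.
  rewrite (@kout n.+1); first by rewrite !(mul0r, mulr0).
  apply/negP; rewrite negb_and.
  rewrite ltr_pdivrMr ?subr_gt0// mul1r -leNgt; apply/orP; right.
  by move: xy1; rewrite -leNgt; lra.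
have c0 : 0 < 1 - x by lra.
have x01 : 0 < x < 1 by apply/andP; split; lra.
have y01 : 0 < y / (1 - x) < 1.
  by rewrite divr_gt0//= ltr_pdivrMr// mul1r; lra.
rewrite /k !bker_in// !mulr1.
rewrite (_ : 1 - y / (1 - x) = (1 - x - y) / (1 - x)); last first.
  by rewrite mulrBl divff// gt_eqF.
have ci0 : 0 <= (1 - x)^-1 by rewrite invr_ge0 ltW.
rewrite (_ : 1 - al - 1 = - al); last lra.
rewrite (powRM _ (ltW y0) ci0) (@powRM _ (1 - x - y)); [|lra|by []].
rewrite !powRV// opprK.
set cc := 1 - x.
(* The exponents add up to [b n + al - b n.+1], which is 0 by [bS]: the increment [al] of the second
   Beta parameter is exactly what makes [K] symmetric. *)
have ccE : cc `^ (b n - 1) * cc `^ al * cc `^ (- (b n.+1 - 1)) = 1.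
  rewrite -!powRD ?(gt_eqF c0) ?implybT// bS.
  by rewrite (_ : _ + _ = 0) ?powRr0//; ring.
transitivity (C n * C n.+1 * (x `^ (- al) * y `^ (- al) * (cc - y) `^ (b n.+1 - 1)) *
  (cc `^ (b n - 1) * cc `^ al * cc `^ (- (b n.+1 - 1)))); first ring.
by rewrite ccE mulr1.
Qed.

Let Ksym n x y : K n x y = K n y x.
Proof. by rewrite !KE (addrC y) (addrAC 1 (- y)); ring. Qed.

Let K_ge0 n x y : 0 <= K n x y. Proof. exact: mulr_ge0. Qed.

Let mK n d (T : measurableType d) (f g : T -> R) : measurable_fun setT f ->
  measurable_fun setT g -> measurable_fun setT (fun z => K n (f z) (g z)).
Proof.
move=> mf mg; apply: measurable_funM; apply: mk => //.
by apply: measurable_funM => //; apply: measurable_fun_inv; exact: measurable_funB.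
Qed.

Let G1 n (f : R -> R) x y :=
  K n x y * (f y * (x <= y)%R%:R / y * M n.+2 (1 - x - y) y).
Let G2 n (f : R -> R) x y :=
  K n x y * (f x * (y < x)%R%:R / x * M n.+2 (1 - x - y) x).

(** After [z = y / (1 - x)] the size-biasing weight [1 / z] equals [(1 - x) / y], and its numerator
    cancels the Jacobian. *)
Let claim1 n (f : R -> R) x : measurable_fun setT f -> (forall v, 0 <= f v) ->
  ((k n x)%:E * S n.+1 (rest f x) = \int[mu]_y (G1 n f x y)%:E)%E.
Proof.
move=> mf f0; have [x01|x01] := pselect (0 < x < 1); last first.
  rewrite kout// mul0e integral0_eq// => y _.
  by rewrite /G1 /K kout// !mul0r.
have c0 : 0 < 1 - x by move: x01 => /andP[_]; lra.
pose g y := k n.+1 y * rest f x y / y * M n.+2 (1 - y) y.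
have mg : measurable_fun setT g.
  apply: measurable_funM; last by apply: measurable_ltprob; mfun.
  apply: measurable_funM; last by mfun.
  by apply: measurable_funM; [apply: mk; mfun|exact: measurable_rest].
have g0 y : 0 <= g y by apply: S_int_ge0 => v; rewrite rest_ge0.
rewrite /S -/(g _) (integral_scale01 c0 mg g0); last first.
  by move=> y y01; rewrite /g kout// !mul0r.
rewrite -ge0_integralZl_EFin//; last 2 first.
- by move=> y _; rewrite lee_fin mulr_ge0// invr_ge0 ltW.
- apply/measurable_EFinP; apply: measurable_funM; last by mfun.
  by apply: (measurableT_comp mg); mfun.
apply: eq_integral => y _; rewrite -EFinM; congr _%:E.
have cn : (1 - x) != 0 by rewrite gt_eqF.
rewrite /g /G1 /K /rest (_ : (1 - x) * (y / (1 - x)) = y); last by rewrite mulrCA divff ?mulr1.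
rewrite (_ : 1 - y / (1 - x) = (1 - x - y) / (1 - x)); last by rewrite mulrBl divff.
rewrite ltprob_scale// invfM invrK.
transitivity (k n x * k n.+1 (y / (1 - x)) * (f y * (x <= y)%R%:R / y * M n.+2 (1 - x - y) y) * ((1 - x) / (1 - x))); first ring.
by rewrite divff// mulr1.
Qed.

(** Here the next stick is unfolded inside [M n.+1 (1 - x) x] by [ltprob_rec]; the explicit factor
    [1 - x] on the left cancels the Jacobian of the rescaling. *)
Let claim2 n (f : R -> R) x : measurable_fun setT f -> (forall v, 0 <= f v) ->
  ((k n x * (f x * (1 - x) / x * M n.+1 (1 - x) x))%:E =
    \int[mu]_y (G2 n f x y)%:E)%E.
Proof.
move=> mf f0; have [x01|x01] := pselect (0 < x < 1); last first.
  rewrite kout// mul0r integral0_eq// => y _.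
  by rewrite /G2 /K kout// !mul0r.
have /andP[x0 x1] := x01.
have c0 : 0 < 1 - x by lra.
have cn : (1 - x) != 0 by rewrite gt_eqF.
pose g y := k n.+1 y * ((1 - x) * y < x)%R%:R * M n.+2 ((1 - x) * (1 - y)) x.
have mg : measurable_fun setT g.
  apply: measurable_funM; last by apply: measurable_ltprob; mfun.
  by apply: measurable_funM; [apply: mk; mfun|mfun].
have g0 y : 0 <= g y by apply: mulr_ge0 (M0 _ _ _); exact: mulr_ge0.
have ME : ((M n.+1 (1 - x) x)%:E = \int[mu]_y (g y)%:E)%E.
  exact: ltprob_rec (ltW c0).
rewrite mulrA EFinM ME (integral_scale01 c0 mg g0); last first.
  by move=> y y01; rewrite /g kout// !mul0r.
rewrite -ge0_integralZl_EFin//; last 3 first.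
- by move=> y _; rewrite lee_fin mulr_ge0// invr_ge0 ltW.
- apply/measurable_EFinP; apply: measurable_funM; last by mfun.
  by apply: (measurableT_comp mg); mfun.
- apply: mulr_ge0 => //; apply: mulr_ge0; last by rewrite invr_ge0 ltW.
  by apply: mulr_ge0 => //; exact: ltW.
apply: eq_integral => y _; rewrite -EFinM; congr _%:E.
rewrite /g /G2 /K (_ : (1 - x) * (y / (1 - x)) = y); last by rewrite mulrCA divff ?mulr1.
rewrite (_ : (1 - x) * (1 - y / (1 - x)) = 1 - x - y); last first.
  by rewrite mulrBr mulr1 mulrCA divff ?mulr1.
transitivity (k n x * k n.+1 (y / (1 - x)) * (f x * (y < x)%R%:R / x * M n.+2 (1 - x - y) x) * ((1 - x) / (1 - x))); first ring.
by rewrite divff// mulr1.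
Qed.

(** Write [1 / x = 1 + (1 - x) / x]. The term 1 gives [A n f]. The other term is a double integral
    of [G2] by [claim2], which the symmetry of [K] and Tonelli turn into that of [G1], that is, by
    [claim1], the size-biased form of [rest f x]. *)
Lemma biasI_rec n (f : R -> R) : measurable_fun setT f -> (forall v, 0 <= f v) ->
  S n f = (A n f + \int[mu]_x ((k n x)%:E * S n.+1 (rest f x)))%E.
Proof.
move=> mf f0.
have G1_ge0 x y : 0 <= G1 n f x y.
  have [y0|y0] := boolP (0 < y); last by rewrite /G1 KE (negbTE y0) mulr0 !mul0r mulr0 !mul0r.
  apply: mulr_ge0 => //; apply: mulr_ge0 => //; apply: mulr_ge0; last by rewrite invr_ge0 ltW.
  exact: mulr_ge0.
have mG1 : measurable_fun setT (fun z : R * R => (G1 n f z.1 z.2)%:E).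
  apply/measurable_EFinP; apply: measurable_funM; first by apply: mK; mfun.
  apply: measurable_funM; last by apply: measurable_ltprob; mfun.
  apply: measurable_funM; last by mfun.
  by apply: measurable_funM; [apply: (measurableT_comp mf); mfun|mfun].
have BE : (\int[mu]_x (k n x * (f x * (1 - x) / x * M n.+1 (1 - x) x))%:E =
    \int[mu]_x ((k n x)%:E * S n.+1 (rest f x)))%E.
  transitivity (\int[mu]_x \int[mu]_y (G1 n f y x)%:E)%E.
    apply: eq_integral => x _; rewrite claim2//.
    (* [G2] has a strict inequality where [G1] has a weak one, so the two agree only off the
       diagonal; for fixed [x] that is a single point, removed below as a null set. *)
    have fE y : y != x -> G2 n f x y = G1 n f y x.
      move=> yx; rewrite /G1 /G2 Ksym (addrAC 1 (- y)) le_eqVlt (negbTE yx)//.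
    have mG2 : measurable_fun setT (fun y => (G2 n f x y)%:E).
      apply/measurable_EFinP; apply: measurable_funM; first by apply: mK; mfun.
      apply: measurable_funM; last by apply: measurable_ltprob; mfun.
      by mfun.
    have mG1x : measurable_fun setT (fun y => (G1 n f y x)%:E).
      apply/measurable_EFinP; apply: measurable_funM; first by apply: mK; mfun.
      apply: measurable_funM; last by apply: measurable_ltprob; mfun.
      by mfun.
    transitivity (\int[mu]_(y in [set: R] `\ x) (G2 n f x y)%:E)%E.
      rewrite integral_setD1; [by []|exact: measurableD|exact: measurable_funTS].
    transitivity (\int[mu]_(y in [set: R] `\ x) (G1 n f y x)%:E)%E.
      by apply: eq_integral => y; rewrite inE => -[_ /eqP yx]; rewrite fE.
    rewrite integral_setD1; [by []|exact: measurableD|exact: measurable_funTS].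
  transitivity (\int[mu]_x \int[mu]_y (G1 n f x y)%:E)%E; last first.
    by apply: eq_integral => x _; rewrite claim1.
  apply/esym.
  by have := @fubini_tonelli _ _ (measurableTypeR R) (measurableTypeR R) R mu mu _ mG1 (fun z => G1_ge0 z.1 z.2).
rewrite -BE /A -ge0_integralD//; last 4 first.
- by move=> x _; rewrite lee_fin; apply: mulr_ge0 (k0 _ _) _; exact: mulr_ge0 (f0 _) (M0 _ _ _).
- apply/measurable_EFinP; apply: measurable_funM; first by apply: mk; mfun.
  by apply: measurable_funM => //; apply: measurable_ltprob; mfun.
- move=> x _; rewrite lee_fin; have [/andP[x0 x1]|x01] := pselect (0 < x < 1); last first.
    by rewrite kout// mul0r.
  apply: mulr_ge0 => //; apply: mulr_ge0 => //; apply: mulr_ge0; last by rewrite invr_ge0 ltW.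
  by apply: mulr_ge0 => //; lra.
- apply/measurable_EFinP; apply: measurable_funM; first by apply: mk; mfun.
  apply: measurable_funM; last by apply: measurable_ltprob; mfun.
  by apply: measurable_funM; [apply: measurable_funM => //; mfun|mfun].
apply: eq_integral => x _; rewrite -EFinD; congr _%:E.
have [/andP[x0 x1]|x01] := pselect (0 < x < 1); last by rewrite kout// !mul0r addr0.
have xn : x != 0 by rewrite gt_eqF.
by field.
Qed.

Lemma lawI_le n (f : R -> R) c : measurable_fun setT f -> (forall v, 0 <= f v) ->
  0 <= c -> (forall v, 0 <= v -> f v <= c * v) -> (L n f <= c%:E)%E.
Proof.
move=> mf f0 c0 fc.
have mfE : measurable_fun setT (fun v => (f v)%:E) by exact/measurable_EFinP.
have mI : measurable (~` `[0, 1]%classic : set R) by exact: measurableC.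
rewrite /L (ge0_negligible_integral mI measurableT mfE _ (nu01 n)); last first.
  by move=> v _; rewrite lee_fin.
rewrite setTD setCK.
apply: (@le_trans _ _ (\int[nu n]_(v in `[0%R, 1%R]) (cst c%:E v))%E).
  apply: ge0_le_integral => //.
  - by move=> v _; rewrite lee_fin.
  - exact: measurable_funTS.
  - move=> v; rewrite /= in_itv/= => /andP[v0 v1]; rewrite lee_fin.
    by rewrite (le_trans (fc v v0))// ler_piMr.
rewrite integral_cst// -[leRHS]mule1 lee_wpmul2l ?lee_fin//.
exact: probability_le1.
Qed.

(** The linear bound on [f] is what tames the weight: [f x / x <= c], and the remaining factors are
    a probability density and a probability. *)
Lemma biasI_le n (f : R -> R) c : measurable_fun setT f -> (forall v, 0 <= f v) ->
  0 <= c -> (forall v, 0 <= v -> f v <= c * v) -> (S n f <= c%:E)%E.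
Proof.
move=> mf f0 c0 fc.
rewrite -[leRHS]mule1 -(k1 n) -ge0_integralZl_EFin//; last 2 first.
- by move=> x _; rewrite lee_fin.
- by apply/measurable_EFinP; apply: mk; mfun.
apply: ge0_le_integral => //.
- by move=> x _; rewrite lee_fin; exact: S_int_ge0.
- apply/measurable_EFinP; apply: measurable_funM; last by apply: measurable_ltprob; mfun.
  by apply: measurable_funM; [apply: measurable_funM => //; apply: mk; mfun|mfun].
- by apply/measurable_EFinP; apply: measurable_funM => //; apply: mk; mfun.
- move=> x _; rewrite lee_fin.
  have [/andP[x0 x1]|x01] := pselect (0 < x < 1); last by rewrite kout// !(mul0r, mulr0).
  have fx : f x / x <= c by rewrite ler_pdivrMr// fc// ltW.
  rewrite -[leRHS]mulr1; apply: ler_pM => //; last exact: ltprob_le1.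
  + by apply: mulr_ge0; [exact: mulr_ge0|rewrite invr_ge0 ltW].
  + by rewrite -mulrA (mulrC c) ler_wpM2l.
Qed.

Let e n := b n / (1 - al + b n).

Let k_onem n : (\int[mu]_x ((k n x)%:E * (1 - x)%:E) = (e n)%:E)%E.
Proof.
have mb : measurable_fun setT (fun x : measurableTypeR R => (bker (1 - al) (b n) x)%:E).
  by apply/measurable_EFinP; exact: measurable_bker.
have IE : (\int[mu]_x (bker (1 - al) (b n) x)%:E = (C n)^-1%:E)%E.
  have := k1 n; rewrite /k.
  have -> : (\int[mu]_x (C n * bker (1 - al) (b n) x)%:E =
      (C n)%:E * \int[mu]_x (bker (1 - al) (b n) x)%:E)%E.
    rewrite -ge0_integralZl_EFin//; last exact: ltW.
    by move=> x _; rewrite lee_fin bker_ge0.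
  have : (0 <= \int[mu]_x (bker (1 - al) (b n) x)%:E)%E.
    by apply: integral_ge0 => x _; rewrite lee_fin bker_ge0.
  (* An infinite integral times [C n > 0] would be infinite, against the normalisation [k1]. *)
  case: (\int[mu]_x (bker (1 - al) (b n) x)%:E)%E => [u _||//].
  + rewrite -EFinM => -[uE]; congr _%:E.
    by apply: (mulfI (lt0r_neq0 (C_gt0 n))); rewrite uE divff// lt0r_neq0.
  + by move=> _; rewrite gt0_muley// lte_fin.
have a0 : 0 < 1 - al by rewrite subr_gt0.
have := integral_bker_onem a0 (b_gt0 n) IE.
have mo : measurable_fun setT (fun x : measurableTypeR R => ((1 - x) * bker (1 - al) (b n) x)%:E).
  under eq_fun do rewrite bker_onem.
  by apply/measurable_EFinP; exact: measurable_bker.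
move=> E; transitivity ((C n)%:E * \int[mu]_x ((1 - x) * bker (1 - al) (b n) x)%:E)%E.
  rewrite -ge0_integralZl_EFin//; last 2 first.
  - by move=> x _; rewrite lee_fin bker_onem bker_ge0.
  - exact: ltW.
  by apply: eq_integral => x _; rewrite -!EFinM /k; congr _%:E; ring.
by rewrite E -EFinM /e mulrCA divff ?mulr1// lt0r_neq0.
Qed.

Let pm n m := \prod_(i < m) e (n + i).

Let e_ge0 n : 0 <= e n.
Proof. by rewrite divr_ge0 ?(ltW (b_gt0 n))// addr_ge0 ?(ltW (b_gt0 n))// subr_ge0 ltW. Qed.

Let pmS n m : pm n m.+1 = e n * pm n.+1 m.
Proof.
rewrite /pm big_ord_recl addn0; congr (_ * _); apply: eq_bigr => i _.
by rewrite lift0 addSnnS.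
Qed.

Let pm_ge0 n m : 0 <= pm n m.
Proof. by apply: prodr_ge0 => i _. Qed.

Let rest_le (f : R -> R) c x v : 0 <= c -> (forall v, 0 <= v -> f v <= c * v) ->
  0 < x < 1 -> 0 <= v -> rest f x v <= c * (1 - x) * v.
Proof.
move=> c0 fc /andP[x0 x1] v0; have xv : 0 <= (1 - x) * v by apply: mulr_ge0 => //; lra.
rewrite /rest -mulrA; case: (x <= _); rewrite ?mulr1 ?fc// mulr0.
exact: mulr_ge0.
Qed.

(* Iterating the two recursions [m] times leaves a discrepancy of at most
   [c E((1 - Y_n) ... (1 - Y_(n+m-1)))]. *)
Let compare m : forall n (f : R -> R) c, measurable_fun setT f ->
  (forall v, 0 <= f v) -> 0 <= c -> (forall v, 0 <= v -> f v <= c * v) ->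
  (L n f <= S n f + (c * pm n m)%:E)%E /\ (S n f <= L n f + (c * pm n m)%:E)%E.
Proof.
elim: m => [|m ih] n f c mf f0 c0 fc.
  rewrite /pm big_ord0 mulr1; split.
    by apply: le_trans (lawI_le n mf f0 c0 fc) _; rewrite leeDr// biasI_ge0.
  by apply: le_trans (biasI_le n mf f0 c0 fc) _; rewrite leeDr// lawI_ge0.
have mkE : measurable_fun setT (fun x : measurableTypeR R => (k n x)%:E).
  by apply/measurable_EFinP; apply: mk; mfun.
have mLr : measurable_fun setT (fun x : measurableTypeR R => L n.+1 (rest f x)).
  exact: measurable_lawI_rest.
have mSr : measurable_fun setT (fun x : measurableTypeR R => S n.+1 (rest f x)).
  exact: measurable_biasI_rest.
have Lr0 x : (0 <= L n.+1 (rest f x))%E by apply: lawI_ge0 => v; rewrite rest_ge0.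
have Sr0 x : (0 <= S n.+1 (rest f x))%E by apply: biasI_ge0 => v; rewrite rest_ge0.
pose w x : \bar R := ((k n x)%:E * (1 - x)%:E)%E.
have w0 x : (0 <= w x)%E.
  rewrite /w -EFinM lee_fin; have [/andP[_ x1]|x01] := pselect (0 < x < 1).
    by apply: mulr_ge0 => //; lra.
  by rewrite kout// mul0r.
have mw : measurable_fun setT (w : measurableTypeR R -> _).
  by apply: emeasurable_funM => //; apply/measurable_EFinP; mfun.
(* Integrating the error [c * (1 - x) * pm n.+1 m] against the density of the stick produces the
   mean [e n], hence the next product [pm n m.+1]. *)
have step (U V : R -> \bar R) :
    measurable_fun setT (U : measurableTypeR R -> _) ->
    measurable_fun setT (V : measurableTypeR R -> _) ->
    (forall x, 0 <= U x)%E -> (forall x, 0 <= V x)%E ->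
    (forall x, 0 < x < 1 -> (U x <= V x + (c * (1 - x) * pm n.+1 m)%:E)%E) ->
    (\int[mu]_x ((k n x)%:E * U x) <=
      \int[mu]_x ((k n x)%:E * V x) + (c * pm n m.+1)%:E)%E.
  move=> mU mV U0 V0 UV.
  have -> : (c * pm n m.+1)%:E = (\int[mu]_x ((c * pm n.+1 m)%:E * w x))%E.
    rewrite ge0_integralZl_EFin//; last by rewrite mulr_ge0.
    by rewrite k_onem -EFinM pmS; congr _%:E; ring.
  have mkV : measurable_fun setT (fun x : measurableTypeR R => ((k n x)%:E * V x)%E).
    exact: emeasurable_funM.
  have mcw : measurable_fun setT (fun x : measurableTypeR R => ((c * pm n.+1 m)%:E * w x)%E).
    exact: emeasurable_funM.
  have cw0 x : (0 <= (c * pm n.+1 m)%:E * w x)%E by rewrite mule_ge0// lee_fin mulr_ge0.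
  have kV0 x : (0 <= (k n x)%:E * V x)%E by rewrite mule_ge0// lee_fin.
  rewrite -ge0_integralD//.
  apply: ge0_le_integral => //.
  - by move=> x _; rewrite mule_ge0// lee_fin.
  - exact: emeasurable_funM.
  - exact: emeasurable_funD.
  - move=> x _; have [x01|x01] := pselect (0 < x < 1); last first.
      by rewrite /w kout// !mul0e mule0 addr0.
    have x1 : 0 <= 1 - x by move: x01 => /andP[_]; lra.
    apply: (@le_trans _ _ ((k n x)%:E * (V x + (c * (1 - x) * pm n.+1 m)%:E))%E).
      by apply: lee_wpmul2l; rewrite ?lee_fin// UV.
    rewrite ge0_muleDr//; last by rewrite lee_fin !mulr_ge0.
    rewrite leeD2l// /w -!EFinM lee_fin le_eqVlt; apply/orP; left; apply/eqP; ring.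
have cmp x : 0 < x < 1 ->
  (L n.+1 (rest f x) <= S n.+1 (rest f x) + (c * (1 - x) * pm n.+1 m)%:E)%E /\
  (S n.+1 (rest f x) <= L n.+1 (rest f x) + (c * (1 - x) * pm n.+1 m)%:E)%E.
  (* By [rest_le], the function [rest f x] has the smaller linear constant [c * (1 - x)]; the
     induction therefore quantifies over [n], [f] and [c]. *)
  move=> x01; apply: ih.
  - exact: measurable_rest.
  - by move=> v; rewrite rest_ge0.
  - by apply: mulr_ge0 => //; move: x01 => /andP[_]; lra.
  - by move=> v v0; exact: rest_le.
rewrite lawI_rec// biasI_rec//; split; rewrite -(addeA (A n f)); apply: leeD2l.
- apply: (step (fun x => L n.+1 (rest f x)) (fun x => S n.+1 (rest f x))) => //.
  by move=> x /cmp[].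
- apply: (step (fun x => S n.+1 (rest f x)) (fun x => L n.+1 (rest f x))) => //.
  by move=> x /cmp[].
Qed.

(** Since [1 / e q = 1 + (1 - al) / b q], and a product of such factors is at least 1 plus the sum
    of the [(1 - al) / b q], one gets [pm * (1 + sg) <= 1]; and [sg] diverges by comparison with the
    harmonic series. *)
Let pm_small n c eps : 0 <= c -> 0 < eps -> exists m, c * pm n m <= eps.
Proof.
move=> c0 eps0.
pose sg n m := \sum_(i < m) (1 - al) / b (n + i).
have sg0 q m : 0 <= sg q m.
  by apply: sumr_ge0 => i _; rewrite divr_ge0 ?(ltW (b_gt0 _))// subr_ge0 ltW.
have pmsg m : forall q, pm q m * (1 + sg q m) <= 1.
  elim: m => [|m ih] q; first by rewrite /pm /sg !big_ord0 addr0 mulr1.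
  have sgS : sg q m.+1 = (1 - al) / b q + sg q.+1 m.
    rewrite /sg big_ord_recl addn0; congr (_ + _); apply: eq_bigr => i _.
    by rewrite lift0 addSnnS.
  have u0 : 0 <= (1 - al) / b q by rewrite divr_ge0 ?(ltW (b_gt0 _))// subr_ge0 ltW.
  rewrite pmS sgS; apply: le_trans (ih q.+1).
  have eE : e q * (1 + (1 - al) / b q) = 1.
    rewrite /e; field; rewrite (lt0r_neq0 (b_gt0 q)) lt0r_neq0//.
    by rewrite addr_gt0// subr_gt0.
  rewrite -[leRHS]mul1r -[X in X * (pm _ _ * _)]eE.
  rewrite -subr_ge0 (_ : _ - _ = e q * pm q.+1 m * ((1 - al) / b q * sg q.+1 m)); last ring.
  by apply: mulr_ge0; apply: mulr_ge0.
have bE m : b (n + m) = b n + m%:R * al.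
  elim: m => [|m ih]; first by rewrite addn0 mul0r addr0.
  by rewrite addnS bS ih -natr1; ring.
(* Because [al < 1], [b (n + i) = b n + i * al] is at most [(b n + 1) * (i + 1)]. *)
have sgge m : (1 - al) / (b n + 1) * series harmonic m <= sg n m.
  rewrite /series/= big_mkord /sg mulr_sumr; apply: ler_sum => i _.
  rewrite -mulrA; apply: ler_wpM2l; first by rewrite subr_ge0 ltW.
  rewrite -invfM lef_pV2 ?posrE ?mulr_gt0 ?ltr0n ?addr_gt0//.
  rewrite bE -natr1; have := b_gt0 n; have : (0 : R) <= i%:R by [].
  move=> i0 bn; have h1 : i%:R * al <= i%:R by rewrite ler_piMr// ltW.
  have h2 : 0 <= b n * i%:R by rewrite mulr_ge0// ltW.
  by rewrite mulrDl mulrDr mulr1 mul1r; lra.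
have : (series (@harmonic R)) x @[x --> \oo] --> +oo.
  apply: nondecreasing_dvgn_lt; last exact: dvg_harmonic.
  by apply/nondecreasing_seqP => m; rewrite /series/= [leRHS]big_nat_recr//= lerDl.
have bn1 : 0 < b n + 1 by rewrite addr_gt0.
have a1 : 0 < 1 - al by rewrite subr_gt0.
(* The threshold for the harmonic sum is the one that makes [sg n N] at least [c / eps]. *)
move=> /cvgryPge /(_ (c / eps / ((1 - al) / (b n + 1)))) [N _ /(_ N (leqnn _)) /= hN].
exists N.
have {}hN : c / eps <= sg n N.
  have d0 : 0 < (1 - al) / (b n + 1) by rewrite divr_gt0.
  by move: hN; rewrite ler_pdivrMr// [leRHS]mulrC => /le_trans; apply; exact: sgge.
have h1 : c <= eps * (1 + sg n N).
  move: hN; rewrite ler_pdivrMr//; nra.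
have := pmsg N n; have := pm_ge0 n N; have := sg0 n N.
move: (sg n N) (pm n N) h1 => s p h1 s0 p0 h2.
apply: (@le_trans _ _ (eps * (1 + s) * p)); first exact: ler_wpM2r.
by rewrite -mulrA (mulrC _ p) ler_piMr// ltW.
Qed.

Lemma lawI_biasI_lin n (f : R -> R) c : measurable_fun setT f ->
  (forall v, 0 <= f v) -> 0 <= c -> (forall v, 0 <= v -> f v <= c * v) ->
  L n f = S n f.
Proof.
move=> mf f0 c0 fc; apply/eqP; rewrite eq_le; apply/andP; split;
  apply/lee_addgt0Pr => eps eps0; have [m hm] := pm_small n c0 eps0.
- by apply: le_trans (compare m n mf f0 c0 fc).1 _; rewrite leeD2l// lee_fin.
- by apply: le_trans (compare m n mf f0 c0 fc).2 _; rewrite leeD2l// lee_fin.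
Qed.

(* Size-biased sampling: the largest atom is picked first with probability equal
   to its size. *)
Lemma lawI_biasI n (f : R -> R) eps : measurable_fun setT f ->
  (forall v, 0 <= f v) -> 0 < eps -> (forall v, v < eps -> f v = 0) ->
  L n f = S n f.
Proof.
move=> mf f0 eps0 feps.
(* Below [eps] the truncation is 0 and above it is at most [N <= (N / eps) * v], so [lawI_biasI_lin]
   applies to every [g N]; monotone convergence then acts on both sides. *)
pose g (N : nat) v := Num.min (f v) N%:R.
have mg N : measurable_fun setT (g N) by exact: measurable_minr.
have g0 N v : 0 <= g N v by rewrite le_min f0 ler0n.
have gnd v : {homo (fun N => g N v) : N N' / (N <= N')%N >-> N <= N'}.
  by move=> N N' NN'; rewrite le_min ge_min lexx/= ge_min ler_nat NN' orbT.
have gE v : \forall N \near \oo, g N v = f v.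
  exists (Num.bound (f v)) => // N /= hN; apply: min_idPl.
  by rewrite (le_trans (ltW (archi_boundP (f0 v))))// ler_nat.
have LSg N : L n (g N) = S n (g N).
  apply: (@lawI_biasI_lin _ _ (N%:R / eps)) => //.
    by rewrite divr_ge0// ltW.
  move=> v v0; have [veps|veps] := ltP v eps.
    rewrite /g feps// min_l//; apply: mulr_ge0 => //.
    by rewrite divr_ge0// ltW.
  rewrite ge_min; apply/orP; right; rewrite -mulrA ler_peMr//.
  by rewrite mulrC ler_pdivlMr// mul1r.
have cL : L n (g N) @[N --> \oo] --> L n f.
  have := @cvg_monotone_convergence _ _ R (nu n) setT measurableT
    (fun N v => (g N v)%:E).
  rewrite (_ : (\int[nu n]_x (fun x0 : R => limn (fun N => (g N x0)%:E)) x)%E = L n f).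
    apply.
    - by move=> N; exact/measurable_EFinP.
    - by move=> N v _; rewrite lee_fin.
    - by move=> v _ N N' NN'; rewrite lee_fin gnd.
  apply: eq_integral => v _; apply: lim_near_cst => //.
  by near=> N; congr _%:E; near: N; exact: gE.
have cS : S n (g N) @[N --> \oo] --> S n f.
  have := @cvg_monotone_convergence _ _ R mu setT measurableT
    (fun N x => (k n x * g N x / x * M n.+1 (1 - x) x)%:E).
  rewrite (_ : (\int[mu]_x (fun x0 : R =>
      limn (fun N => (k n x0 * g N x0 / x0 * M n.+1 (1 - x0) x0)%:E)) x)%E = S n f).
    apply.
    - move=> N; apply/measurable_EFinP; apply: measurable_funM; last by apply: measurable_ltprob; mfun.
      by apply: measurable_funM; [apply: measurable_funM; [apply: mk; mfun|exact: mg]|mfun].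
    - by move=> N x _; rewrite lee_fin; exact: S_int_ge0.
    - move=> x _ N N' NN'; rewrite lee_fin.
      have [/andP[x0 x1]|x01] := pselect (0 < x < 1); last by rewrite kout// !mul0r.
      apply: ler_wpM2r => //; apply: ler_wpM2r; first by rewrite invr_ge0 ltW.
      by apply: ler_wpM2l => //; exact: gnd.
  apply: eq_integral => x _; apply: lim_near_cst => //.
  near=> N; rewrite (_ : g N x = f x)//; near: N; exact: gE.
apply: (cvg_unique _ cL) => //.
by rewrite (_ : (fun N => L n (g N)) = (fun N => S n (g N))) //; apply/funext.
Unshelve. all: by end_near.
Qed.

End size_bias.

(** * The substitution in the size-biased integral *)

Section substitution.
Context {R : realType}.
Notation mu := (@lebesgue_measure R).
Variables (al th s C0 : R) (nu : probability R R).
Hypothesis s1 : 1 < s.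

Let phi z : R := (s - (s - 1) * z)^-1.
Let k x := C0 * bker (1 - al) (th + al) x.
Let M := ltprob nu.

(** The integrand of the theorem at [t = 1 / v]. For [v > 0] the two indicators say
    [s - 1 < t <= s], written without division. *)
Definition dickman_test (v : R) : R := (1 <= s * v)%R%:R * ((s - 1) * v < 1)%R%:R *
  ((s - v^-1) `^ (- al) * v^-1 `^ th).

Lemma dickman_test_ge0 v : 0 <= dickman_test v.
Proof. by rewrite !mulr_ge0 ?powR_ge0. Qed.

Lemma measurable_dickman_test : measurable_fun setT dickman_test.
Proof. by rewrite /dickman_test; mfun. Qed.

Let H x := k x * dickman_test x / x * M (1 - x) x.
Let J z := k z * ((s - 1) * z < 1)%R%:R * M ((s - 1) * (1 - z)) 1.

Let u_ge1 z : z <= 1 -> 1 <= s - (s - 1) * z.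
Proof.
move=> z1; have : (s - 1) * z <= s - 1 by rewrite ler_piMr// subr_ge0 ltW.
by lra.
Qed.

(** Put [u = 1 / phi z]. Then [s - u = (s - 1) * z] and [1 - 1/u = (s - 1) * (1 - z) / u]. With the
    Jacobian [(s - 1) / u^2], the powers of [u] cancel because the second Beta parameter is
    [th + al], and those of [s - 1] combine to the exponent [th]. *)
Let HJ z : 0 < z < 1 -> H (phi z) * ((s - 1) * (phi z * phi z)) = (s - 1) `^ th * J z.
Proof.
move=> z01; have /andP[z0 z1] := z01.
have s0 : 0 < s - 1 by rewrite subr_gt0.
rewrite /H /J /phi; set u := s - (s - 1) * z.
have sz0 : 0 < (s - 1) * z by rewrite mulr_gt0.
have sz1 : (s - 1) * z < s - 1 by rewrite gtr_pMr.
have u1 : 1 < u by rewrite /u; lra.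
have us : u < s by rewrite /u; lra.
have u0 : 0 < u by lra.
have un : u != 0 by rewrite gt_eqF.
have z1' : 0 < 1 - z by rewrite subr_gt0.
have x01 : 0 < u^-1 < 1 by rewrite invr_gt0 u0 invf_lt1.
have xE : 1 - u^-1 = (s - 1) * (1 - z) / u.
  have e1 : (s - 1) * (1 - z) = u - 1 by rewrite /u; ring.
  by rewrite e1 mulrBl divff// mul1r.
rewrite /dickman_test invrK.
rewrite (_ : (1 <= s * u^-1)%R = true); last by rewrite ler_pdivlMr// mul1r ltW.
rewrite (_ : ((s - 1) * u^-1 < 1) = ((s - 1) * z < 1)); last first.
  rewrite ltr_pdivrMr// mul1r /u -[LHS]subr_gt0 -[RHS]subr_gt0; congr (_ < _); ring.
rewrite (_ : s - u = (s - 1) * z); last by rewrite /u; ring.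
have -> : M (1 - u^-1) u^-1 = M ((s - 1) * (1 - z)) 1.
  by rewrite xE -[X in M _ X]mul1r /M ltprob_scale.
move: (M _ _) => m; rewrite /k !bker_in// xE.
rewrite (_ : 1 - al - 1 = - al); last lra.
set B := th + al - 1.
have powV (c p : R) : 0 < c -> c^-1 `^ p = c `^ (- p).
  by move=> c0; rewrite -powR_inv1 ?ltW// -powRrM mulN1r.
have ui0 : 0 <= u^-1 by rewrite invr_ge0 ltW.
rewrite (@powRM _ ((s - 1) * (1 - z)) u^-1 B)//; last by rewrite mulr_ge0// ltW.
rewrite !powRM ?(ltW s0) ?(ltW z0) ?(ltW z1')// !powV// opprK.
have uE : u `^ al * u `^ (- B) * u `^ th = u.
  rewrite -!powRD ?un ?implybT//.
  by rewrite (_ : _ + _ + _ = 1) ?powRr1 ?ltW// /B; ring.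
have sE : (s - 1) `^ B * (s - 1) `^ (- al) * (s - 1) = (s - 1) `^ th.
  rewrite -[X in _ * X = _](powRr1 (ltW s0)) -!powRD ?(gt_eqF s0) ?implybT//.
  by congr (_ `^ _); rewrite /B; ring.
rewrite -sE; move: ((_ < _)%R) => ind.
rewrite mul1r; move: (ind%:R : R) uE => {}ind.
move: (u `^ al) (u `^ (- B)) (u `^ th) ((s - 1) `^ B) ((s - 1) `^ (- al))
  (z `^ (- al)) ((1 - z) `^ B) => a1 a2 a3 a4 a5 a6 a7 uE.
transitivity (C0 * (a4 * a5 * (s - 1)) * (a6 * a7) * ind * m *
   ((a1 * a2 * a3) * u * (u^-1 * u^-1))); first ring.
have uu : u * u * (u^-1 / u) = 1 by field.
by rewrite uE uu; ring.
Qed.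

Hypothesis C0_ge0 : 0 <= C0.

Let k_out x : ~ (0 < x < 1) -> k x = 0.
Proof. by move=> x01; rewrite /k bker_out// mulr0. Qed.

Let mH : measurable_fun setT H.
Proof.
apply: measurable_funM; last by apply: measurable_ltprob; mfun.
apply: measurable_funM; last by mfun.
apply: measurable_funM; last exact: measurable_dickman_test.
by apply: measurable_funM => //; exact: measurable_bker.
Qed.

Let H_ge0 x : 0 <= H x.
Proof.
have [x01|x01] := pselect (0 < x < 1); last by rewrite /H k_out// !mul0r.
have /andP[x0 _] := x01.
rewrite /H; apply: mulr_ge0; last exact: ltprob_ge0.
apply: mulr_ge0; last by rewrite invr_ge0 ltW.
by apply: mulr_ge0 (dickman_test_ge0 _); apply: mulr_ge0 => //; exact: bker_ge0.
Qed.

(* The substitution 1/x = s - (s-1) z. *)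
Lemma size_biased_substitution :
  (\int[mu]_x (H x)%:E = \int[mu]_z ((s - 1) `^ th * J z)%:E)%E.
Proof.
have s0 : 0 < s by rewrite (lt_trans _ s1).
have s10 : 0 < s - 1 by rewrite subr_gt0.
have mphi : measurable_fun setT phi by rewrite /phi; mfun.
have phi0 : phi 0 = s^-1 by rewrite /phi mulr0 subr0.
have phi1 : phi 1 = 1 by rewrite /phi mulr1 subKr invr1.
rewrite [RHS](@integral_support _ `]0%R, 1%R[%classic); last first.
  by move=> z; rewrite /= in_itv/= => z01; rewrite /J k_out// !mul0r mulr0.
rewrite (@integral_support _ `[s^-1, 1%R[%classic); last first.
  move=> x; rewrite /= in_itv/= => /negP; rewrite negb_and => /orP[xs|x1].
    rewrite /H /dickman_test (_ : (1 <= s * x)%R = false) ?(mul0r, mulr0)//.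
    by apply/negbTE; rewrite mulrC -ler_pdivrMr// mul1r.
  by rewrite /H k_out ?mul0r//; apply/negP; rewrite negb_and x1 orbT.
(* The left end point is dropped so that the domain becomes the image of the open unit interval,
   with [phi 0 = 1/s] and [phi 1 = 1]. *)
rewrite -integral_itv_obnd_cbnd; last first.
  by apply/measurable_EFinP; exact: measurable_funTS.
have cphi z : z <= 1 -> {for z, continuous phi}.
  move=> z1; apply: (@continuousV _ _ (fun z : R => s - (s - 1) * z) z).
    by rewrite gt_eqF// (lt_le_trans _ (u_ge1 z1)).
  apply: cvgB; first exact: cvg_cst.
  by apply: cvgM; [exact: cvg_cst|exact: cvg_id].
have := @ge0_change_of_variables R phi (fun z => (s - 1) * (phi z * phi z))
  (fun x => (s - x^-1) / (s - 1)) 0 1 (EFin \o H) ltr01 mphi.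
rewrite phi0 phi1 => cov.
transitivity (\int[mu]_(z in `]0%R, 1%R[)
   ((EFin \o H) (phi z) * ((s - 1) * (phi z * phi z))%:E))%E; last first.
  apply: eq_integral => z; rewrite inE/= in_itv/= => z01.
  by rewrite -EFinM HJ.
apply: cov.
- by apply: measurable_funM => //; exact: measurable_funM.
- move=> x y; rewrite !in_itv/= => /andP[_ x1] /andP[_ y1].
  have ux := lt_le_trans ltr01 (u_ge1 x1); have uy := lt_le_trans ltr01 (u_ge1 y1).
  by rewrite /phi ltf_pV2 ?posrE// ltrD2l ltrN2 ltr_pM2l.
- move=> t /andP[ts t1]; have t0 : 0 < t by rewrite (lt_trans _ ts)// invr_gt0.
  have ti1 : 1 < t^-1 by rewrite invf_gt1.
  have tis : t^-1 < s by rewrite -[ltRHS]invrK ltf_pV2 ?posrE ?invr_gt0.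
  split; last by rewrite /phi mulrC divfK ?gt_eqF// subKr invrK.
  by rewrite divr_gt0 ?subr_gt0//= ltr_pdivrMr// mul1r; lra.
- by move=> z; rewrite -expr2 mulr_ge0 ?sqr_ge0// ltW.
- move=> z; rewrite in_itv/= => /andP[_ z1].
  apply: cvgM; first exact: cvg_cst.
  by apply: cvgM; exact: cphi (ltW z1).
- by move=> z; rewrite in_itv/= => /andP[_ z1]; exact: cphi.
- move=> z /andP[_ z1].
  have un : s - (s - 1) * z != 0 by rewrite gt_eqF// (lt_le_trans _ (u_ge1 (ltW z1))).
  have h : is_derive z 1 (cst s - ((s - 1) \*: id)) (0 - (s - 1) *: (1 : R)).
    by apply: is_deriveB; exact: is_deriveZ.
  pose f := cst s - ((s - 1) \*: id) : R -> R.
  have dV : derivable (fun y => (f y)^-1) z 1 by apply: derivableV => //; case: h.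
  suff <- : 'D_1 (fun y => (f y)^-1) z = (s - 1) * (phi z * phi z) by exact: derivableP.
  rewrite deriveV// (_ : 'D_1 f z = 0 - (s - 1) *: (1 : R)); last by case: h.
  rewrite /phi /GRing.scale/= mulr1 sub0r mulrNN mulrC.
  by rewrite expr2 invfM.
- exact/measurable_EFinP.
- by move=> x; rewrite lee_fin.
Qed.

End substitution.

(** * The largest stick: measurability, bounds and recursion *)

Section stick_breaking.
Context {R : realType}.

Lemma measurable_stick d (T : measurableType d) (Z : nat -> T -> R) i :
  (forall i, measurable_fun setT (Z i)) -> measurable_fun setT (stick Z i).
Proof.
move=> mZ; apply: measurable_funM => //.
elim: i => [|i ih].
  by under eq_fun do rewrite big_ord0; exact: measurable_cst.
under eq_fun do rewrite big_ord_recr/=.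
by apply: measurable_funM => //; exact: measurable_funB.
Qed.

Lemma measurable_V1 d (T : measurableType d) (Z : nat -> T -> R) :
  (forall i, measurable_fun setT (Z i)) -> measurable_fun setT (V1 Z).
Proof.
move=> mZ.
have VE : V1 Z = fun w => fine (esups (fun i => (stick Z i w)%:E) 0).
  apply/funext => w; rewrite /V1 /esups/= /sdrop.
  rewrite (_ : [set _ | k in _] = EFin @` range (fun i => stick Z i w)); last first.
    apply/seteqP; split => [_ [i _ <-]|_ [_ [i _ <-] <-]]; last by exists i.
    by exists (stick Z i w) => //; exists i.
  have ne : range (fun i => stick Z i w) !=set0 by exists (stick Z 0%N w), 0%N.
  have [ub|nub] := pselect (has_ubound (range (fun i => stick Z i w))).
    by rewrite ereal_sup_EFin.
  (* For an unbounded sequence the default values agree: [fine] of [+oo] and the real [sup] are both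
     0. *)
  by rewrite hasNub_ereal_sup//= sup_out// => -[].
rewrite VE; apply: (measurableT_comp (@fine_measurable R setT measurableT)).
apply: measurable_fun_esups => i.
by apply/measurable_EFinP; exact: measurable_stick.
Qed.

Section pointwise.
Variables (T : Type) (Z : nat -> T -> R) (w : T).
Hypothesis Z01 : forall i, 0 < Z i w < 1.

Let Zgt0 i : 0 < Z i w. Proof. by have /andP[] := Z01 i. Qed.
Let Zle1 i : 0 <= 1 - Z i w. Proof. by have /andP[_ /ltW] := Z01 i; rewrite subr_ge0. Qed.

Lemma stick01 i : 0 <= stick Z i w <= 1.
Proof.
have p01 : 0 <= \prod_(j < i) (1 - Z j w) <= 1.
  apply/andP; split; first by apply: prodr_ge0 => j _.
  by apply: prodr_ile1 => j _; rewrite Zle1/= lerBlDr lerDl ltW.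
have /andP[p0 p1] := p01; have /andP[z0 z1] := Z01 i.
rewrite /stick mulr_ge0 ?(ltW z0)//=.
by rewrite -[leRHS]mulr1 ler_pM// ltW.
Qed.

Let has_sup_stick : has_sup (range (fun i => stick Z i w)).
Proof.
split; first by exists (stick Z 0%N w), 0%N.
by exists 1 => _ [i _ <-]; have /andP[] := stick01 i.
Qed.

Lemma stick_le_V1 i : stick Z i w <= V1 Z w.
Proof. by apply: ub_le_sup; [case: has_sup_stick|exists i]. Qed.

Lemma V1_le c : (forall i, stick Z i w <= c) -> V1 Z w <= c.
Proof. by move=> h; apply: ge_sup; [case: has_sup_stick|move=> _ [i _ <-]]. Qed.

Lemma V1_gt0 : 0 < V1 Z w.
Proof.
apply: lt_le_trans (stick_le_V1 0).
by rewrite /stick big_ord0 mulr1.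
Qed.

Lemma V1_le1 : V1 Z w <= 1.
Proof. by apply: V1_le => i; have /andP[] := stick01 i. Qed.

End pointwise.

Lemma V1_rec (T : Type) (Z : nat -> T -> R) w : (forall i, 0 < Z i w < 1) ->
  V1 Z w = Num.max (Z 0%N w) ((1 - Z 0%N w) * V1 (fun i => Z i.+1) w).
Proof.
move=> Z01.
have stick0 : stick Z 0 w = Z 0%N w by rewrite /stick big_ord0 mulr1.
have stickS i : stick Z i.+1 w = (1 - Z 0%N w) * stick (fun i => Z i.+1) i w.
  by rewrite /stick big_ord_recl/= mulrCA.
have ZS01 i : 0 < Z i.+1 w < 1 by [].
have /andP[z0 z1] := Z01 0%N.
have c0 : 0 < 1 - Z 0%N w by rewrite subr_gt0.
apply/eqP; rewrite eq_le; apply/andP; split.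
  apply: V1_le => // -[|i]; first by rewrite stick0 le_max lexx.
  by rewrite stickS le_max ler_pM2l// (stick_le_V1 ZS01) orbT.
rewrite ge_max -stick0 stick_le_V1//= stick0 mulrC -ler_pdivlMr//.
apply: V1_le => // i; rewrite ler_pdivlMr// mulrC -stickS.
exact: stick_le_V1.
Qed.

End stick_breaking.

(** * Independence of one variable from all later ones *)

Section independence.
Context d (T : measurableType d) (R : realType) (P : probability T R).
Variable X : nat -> {RV P >-> R}.
Hypothesis indX : mutually_independent P (fun i => X i : T -> R).

(** Cylinder sets in the variables from index [n] on. Infinite intersections that are eventually
    trivial make closure under intersection coordinatewise; [GE] turns them back into finite
    ones. *)
Let G n : set (set T) := [set E | exists2 B : nat -> set R,
  (forall i, measurable (B i)) /\ (exists m, forall i, (m <= i)%N -> B i = setT) &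
  E = \bigcap_i (X (n + i)%N @^-1` B i)].

Let GI n : setI_closed (G n).
Proof.
move=> _ _ [B [mB [m Bm]] ->] [B' [mB' [m' Bm']] ->].
exists (fun i => B i `&` B' i).
  split; first by move=> i; exact: measurableI.
  exists (maxn m m') => i; rewrite geq_max => /andP[mi m'i].
  by rewrite Bm// Bm'// setIT.
by rewrite -bigcapI; apply: eq_bigcapr => i _; rewrite preimage_setI.
Qed.

Let GE n (B : nat -> set R) m : (forall i, (m <= i)%N -> B i = setT) ->
  \bigcap_i (X (n + i)%N @^-1` B i) =
  \big[setI/setT]_(i <- iota n m) (X i @^-1` B (i - n)%N).
Proof.
move=> Bm; rewrite -bigcap_seq; apply/seteqP; split => w h i /=.
  rewrite mem_iota => /andP[ni _]; have := h (i - n)%N I.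
  by rewrite /= subnKC.
move=> _; have [im|im] := ltnP i m; last by rewrite Bm.
have := h (n + i)%N; rewrite /= mem_iota leq_addr ltn_add2l im addKn.
exact.
Qed.

(** As functions of [E], both sides are finite measures; they agree on the pi-system of cylinders,
    hence on the sigma-algebra it generates. *)
Lemma tail_independence n (A : set R) (E : set T) : measurable A ->
  <<s G n.+1 >> E -> P (X n @^-1` A `&` E) = (P (X n @^-1` A) * P E)%E.
Proof.
move=> mA sE.
have mX i (B : set R) : measurable B -> measurable (X i @^-1` B).
  by move=> mB; rewrite -[X in measurable X]setTI; exact: measurable_funP.
have mXA := mX n A mA.
pose m1 : {measure set T -> \bar R} := mrestr P mXA.
have PA0 : 0 <= fine (P (X n @^-1` A)) by rewrite fine_ge0.
pose m2 : {measure set T -> \bar R} := mscale (NngNum PA0) P.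
have PAE : P (X n @^-1` A) = (fine (P (X n @^-1` A)))%:E.
  by rewrite fineK// fin_num_measure.
suff : m1 E = m2 E by rewrite /m1 /m2 /= /mrestr /mscale/= setIC PAE.
have Gm : G n.+1 `<=` measurable.
  move=> _ [B [mB [m Bm]] ->]; apply: bigcapT_measurable => i; exact: mX.
apply: (g_sigma_algebra_measure_unique (G n.+1) Gm (fun=> setT)) => //.
- move=> _; exists (fun=> setT); first by split => //; exists 0%N.
  by apply/seteqP; split.
- by apply/seteqP; split => // w _; exists 0%N.
- move=> _ [B [mB [m Bm]] ->]; rewrite (GE _ Bm).
  (* [A] is inserted at index [n] in front of the cylinder, so that mutual independence over
     [iota n m.+1] and over [iota n.+1 m] gives the factorisation. *)
  pose B' i := if i == n then A else B (i - n.+1)%N.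
  have mB' i : measurable (B' i) by rewrite /B'; case: ifP.
  have eB' : \big[setI/setT]_(i <- iota n.+1 m) (X i @^-1` B (i - n.+1)%N) =
      \big[setI/setT]_(i <- iota n.+1 m) (X i @^-1` B' i).
    rewrite !big_seq; apply: eq_bigr => i; rewrite mem_iota => /andP[ni _].
    by rewrite /B' gtn_eqF.
  have h1 := indX (iota_uniq n.+1 m) mB'.
  have h2 := indX (iota_uniq n m.+1) mB'.
  rewrite eB' /m1 /m2/= /mrestr /mscale/= h1 -PAE.
  move: h2; rewrite /= !big_cons {1 3}/B' eqxx => h2.
  by rewrite setIC h2.
- move=> _; rewrite /m1/= /mrestr setTI.
  by rewrite (le_lt_trans (probability_le1 _ _))// ltry.
Qed.

Lemma V1_independence n (A B : set R) : measurable A -> measurable B ->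
  P (X n @^-1` A `&` V1 (fun i => X (n.+1 + i)%N : T -> R) @^-1` B) =
  (P (X n @^-1` A) * P (V1 (fun i => X (n.+1 + i)%N : T -> R) @^-1` B))%E.
Proof.
move=> mA mB; apply: tail_independence => //.
(* Measurability of the largest later stick with respect to the generated sigma-algebra is what
   places its preimages there. *)
pose T' := g_sigma_algebraType (G n.+1).
have mX' i : measurable_fun [set: T'] (X (n.+1 + i)%N : T' -> R).
  move=> _ C mC; rewrite setTI; apply: sub_sigma_algebra.
  exists (fun j => if j == i then C else setT).
    split; first by move=> j; case: ifP.
    by exists i.+1 => j ij; rewrite gtn_eqF.
  apply/seteqP; split => w /=.
    by move=> Cw j _ /=; case: ifP => [/eqP ->|].
  by move=> /(_ i I); rewrite /= eqxx.
have mV : measurable_fun [set: T'] (V1 (fun i => X (n.+1 + i)%N : T' -> R)).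
  exact: measurable_V1.
by have := mV measurableT _ mB; rewrite setTI.
Qed.

End independence.

(** * Beta laws as measures with density *)

Section beta_law.
Context d (T : measurableType d) (R : realType) (P : probability T R).
Notation mu := (@lebesgue_measure R).
Variables (X : {RV P >-> R}) (a b : R).
Hypothesis XB : has_Beta_law P X a b.

(** No integral is computed. Were [Beta_fun a b] zero, be it from a null integral or as [fine] of an
    infinite one, division by it would make the density vanish, against total mass 1. *)
Lemma Beta_fun_gt0 : 0 < Beta_fun a b.
Proof.
have B0 : 0 <= Beta_fun a b.
  apply: fine_ge0; apply: integral_ge0 => x _.
  by rewrite lee_fin /beta_kernel mulr_ge0 ?powR_ge0.
rewrite lt_neqAle B0 andbT eq_sym; apply/eqP => BE.
have := XB measurableT; rewrite preimage_setT probability_setT integral0_eq.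
  by move=> /eqP; rewrite onee_eq0.
by move=> x _; rewrite BE invr0 mulr0.
Qed.

Lemma Beta_law_density (A : set R) : measurable A ->
  P (X @^-1` A) = (\int[mu]_(x in A) ((Beta_fun a b)^-1 * bker a b x)%:E)%E.
Proof.
move=> mA; rewrite XB// integral_mkcond [RHS]integral_mkcond.
pose f x := (beta_kernel a b x / Beta_fun a b)%:E.
pose g x := ((Beta_fun a b)^-1 * bker a b x)%:E.
have mf : measurable_fun setT (f : measurableTypeR R -> _).
  apply/measurable_EFinP; apply: measurable_funM; last by mfun.
  by rewrite /beta_kernel; mfun.
have mg : measurable_fun setT (g : measurableTypeR R -> _).
  apply/measurable_EFinP; apply: measurable_funM; first by mfun.
  exact: measurable_bker.
have mI : measurable (`[0, 1]%classic : set (measurableTypeR R)).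
  exact: measurable_itv.
have mf' : measurable_fun setT (f \_ (A `&` `[0, 1]%classic) : measurableTypeR R -> _).
  apply/(measurable_restrictT f); first exact: measurableI.
  exact: measurable_funTS.
have mg' : measurable_fun setT (g \_ A : measurableTypeR R -> _).
  by apply/(measurable_restrictT g) => //; exact: measurable_funTS.
have m0 : measurable ([set: measurableTypeR R] `\ (0 : R)) by exact: measurableD.
have m1 : measurable ([set: measurableTypeR R] `\ (0 : R) `\ (1 : R)) by exact: measurableD.
(* The two kernels may differ at 0 and 1, where only [beta_kernel] is left uncut; both points are
   null and are removed first. *)
have D01 (F : R -> \bar R) : measurable_fun setT (F : measurableTypeR R -> _) ->
    (\int[mu]_x F x = \int[mu]_(x in [set: R] `\ 0%R `\ 1%R) F x)%E.
  move=> mF; rewrite integral_setD1; [|exact: m1|exact: measurable_funTS].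
  by rewrite integral_setD1; [|exact: m0|exact: measurable_funTS].
rewrite [LHS]D01; last exact: mf'.
rewrite [RHS]D01; last exact: mg'.
apply: eq_integral => x; rewrite inE/= => -[[_ x0] x1].
rewrite /patch in_setI; have [xA|xA] //= := boolP (x \in A).
have [x01|x01] := pselect (0 < x < 1).
  rewrite ifT; first by rewrite bker_in// mulrC.
  by rewrite inE/= in_itv/=; move: x01 => /andP[/ltW -> /ltW ->].
rewrite bker_out// mulr0 ifF//; apply/negbTE/negP; rewrite inE/= in_itv/= => /andP[x0' x1'].
by apply: x01; rewrite !lt_neqAle x0' x1' !andbT; apply/andP; split; apply/eqP => // h; exact: x0.
Qed.

Lemma Beta_law_total : (\int[mu]_x ((Beta_fun a b)^-1 * bker a b x)%:E = 1)%E.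
Proof.
by rewrite -(Beta_law_density measurableT) preimage_setT probability_setT.
Qed.

Lemma Beta_law_itv : P (X @^-1` (~` `]0, 1[%classic)) = 0%E.
Proof.
rewrite Beta_law_density; last exact: measurableC.
apply: integral0_eq => x; rewrite /= in_itv/= => /bker_out ->.
by rewrite mulr0.
Qed.

Let h x := (Beta_fun a b)^-1 * bker a b x.
Let mh : measurable_fun [set: measurableTypeR R] h.
Proof. by apply: measurable_funM; [mfun|exact: measurable_bker]. Qed.
Let h0 x : 0 <= h x.
Proof. by rewrite mulr_ge0 ?bker_ge0// invr_ge0 ltW// Beta_fun_gt0. Qed.

Lemma Beta_law_integral (f : R -> \bar R) : measurable_fun setT f ->
  (forall x, 0 <= f x)%E ->
  (\int[distribution P X]_x f x =
   \int[mu]_x (((Beta_fun a b)^-1 * bker a b x)%:E * f x))%E.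
Proof.
move=> mf f0.
(* The law of [X] lives on [R], the density measure on [measurableTypeR R]; pushing forward along
   the identity links the two measurable structures. *)
pose idR : measurableTypeR R -> R := fun x => x.
have mid : measurable_fun setT idR by move=> _ B mB; rewrite setTI.
transitivity (\int[pushforward (density mu mh h0) idR]_x f x)%E.
  apply: eq_measure_integral => A mA _.
  exact: Beta_law_density.
rewrite ge0_integral_pushforward// preimage_setT ge0_integral_density//.
by apply: eq_integral => x _; rewrite muleC.
Qed.

End beta_law.

(** * The Poisson-Dirichlet case and the Stieltjes measure *)

Section poisson_dirichlet.
Context d (T : measurableType d) (R : realType) (P : probability T R).
Notation mu := (@lebesgue_measure R).
Variables (Y : nat -> {RV P >-> R}) (alpha theta : R).
Hypothesis alpha_ge0 : 0 <= alpha.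
Hypothesis alpha_lt1 : alpha < 1.
Hypothesis theta_gt : - alpha < theta.
Hypothesis Y_ind : mutually_independent P (fun i => Y i : T -> R).
Hypothesis Y_beta : forall i : nat,
  has_Beta_law P (Y i) (1 - alpha) (theta + i.+1%:R * alpha).

Let b n := theta + n.+1%:R * alpha.
Let C n := (Beta_fun (1 - alpha) (b n))^-1.
Let k := stick_density alpha b C.

Let b_gt0 n : 0 < b n.
Proof.
have : alpha <= n.+1%:R * alpha by rewrite ler_peMl// ler1n.
by have := theta_gt; rewrite /b; move: (n.+1%:R * alpha) => t; lra.
Qed.

Let bS n : b n.+1 = b n + alpha.
Proof. by rewrite /b -[in LHS]natr1; ring. Qed.

Let C_gt0 n : 0 < C n.
Proof. by rewrite invr_gt0; exact: Beta_fun_gt0 (Y_beta n). Qed.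

Let k1 n : (\int[mu]_x (k n x)%:E = 1)%E.
Proof. exact: Beta_law_total (Y_beta n). Qed.

(** Outside this null set all sticks are positive and the pointwise recursion for the largest one
    holds. *)
Let N : set T := \bigcup_i (Y i @^-1` (~` `]0, 1[%classic)).

Let mN : measurable N.
Proof.
apply: bigcupT_measurable => i; rewrite -[X in measurable X]setTI.
by apply: measurable_funP => //; exact: measurableC.
Qed.

Let PN : P N = 0%E.
Proof.
have mi i : measurable (Y i @^-1` (~` `]0, 1[%classic)).
  by rewrite -[X in measurable X]setTI; apply: measurable_funP => //; exact: measurableC.
have [+ _] := @negligibleP _ _ _ P N mN; apply; apply: negligible_bigcup => i.
have [_] := @negligibleP _ _ _ P _ (mi i); apply.
exact: Beta_law_itv (Y_beta i).
Qed.

Let NN w : ~ N w -> forall i, 0 < Y i w < 1.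
Proof.
by move=> nN i; apply: contrapT => h; apply: nN; exists i.
Qed.

Let integral_off_N (f g : T -> \bar R) : measurable_fun setT f ->
  measurable_fun setT g -> (forall w, 0 <= f w)%E -> (forall w, 0 <= g w)%E ->
  (forall w, ~ N w -> f w = g w) -> (\int[P]_w f w = \int[P]_w g w)%E.
Proof.
move=> mf mg f0 g0 fg.
rewrite (ge0_negligible_integral mN measurableT mf _ PN)//.
rewrite (ge0_negligible_integral mN measurableT mg _ PN)//.
by apply: eq_integral => w; rewrite inE => -[_ /fg].
Qed.

Let V n : T -> R := V1 (fun i => Y (n + i)%N : T -> R).

Let mV n : measurable_fun setT (V n).
Proof. by apply: measurable_V1 => i. Qed.

HB.instance Definition _ n := isMeasurableFun.Build _ _ _ _ (V n) (mV n).

Let nu n : probability R R := distribution P (V n).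

Let V_rec n w : ~ N w -> V n w = Num.max (Y n w) ((1 - Y n w) * V n.+1 w).
Proof.
move=> /NN Y01; rewrite /V V1_rec; last by move=> i; exact: Y01.
rewrite addn0 (_ : (fun i => Y (n + i.+1)%N : T -> R) = (fun i => Y (n.+1 + i)%N))//.
by apply/funext => i; rewrite addnS addSn.
Qed.

Let nu01 n : nu n (~` `[0, 1]%classic) = 0%E.
Proof.
have mI : measurable (V n @^-1` (~` `[0, 1]%classic)).
  by rewrite -[X in measurable X]setTI; apply: mV => //; exact: measurableC.
rewrite -[LHS]/(P (V n @^-1` (~` `[0, 1]%classic))).
apply: (subset_measure0 mI mN _ PN) => w /= h; apply: contrapT => /NN Y01; apply: h.
have Y01' i : 0 < Y (n + i)%N w < 1 by [].
by rewrite in_itv/= (ltW (V1_gt0 Y01')) (V1_le1 Y01').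
Qed.

Let nu_rec n (f : R -> R) : measurable_fun setT f -> (forall v, 0 <= f v) ->
  (\int[nu n]_v (f v)%:E =
   \int[mu]_x ((k n x)%:E *
     \int[nu n.+1]_v (f (Num.max x ((1 - x) * v)%R))%:E))%E.
Proof.
move=> mf f0.
have mfE : measurable_fun setT (fun v => (f v)%:E) by exact/measurable_EFinP.
pose h (z : R * R) : \bar R := (f (Num.max z.1 ((1 - z.1) * z.2)))%:E.
have mh : measurable_fun setT h.
  apply/measurable_EFinP; apply: (measurableT_comp mf).
  by mfun.
have h0 z : (0 <= h z)%E by rewrite lee_fin.
pose pr w := (Y n w, V n.+1 w).
have mpr : measurable_fun setT pr by exact: measurable_fun_pair.
pose prm : {mfun T >-> (R * R)%type} := HB.pack pr (isMeasurableFun.Build _ _ _ _ pr mpr).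
transitivity (\int[P]_w h (pr w))%E.
  rewrite ge0_integral_distribution//; apply: integral_off_N => //.
  - exact: measurableT_comp.
  - exact: measurableT_comp.
  - by move=> w; rewrite /= lee_fin.
  - by move=> w /V_rec VE; rewrite /= VE.
transitivity (\int[distribution P prm]_z h z)%E.
  by rewrite ge0_integral_distribution.
(* Independence makes the joint law of [Y n] and [V n.+1] a product measure, to which Tonelli
   applies. *)
transitivity (\int[distribution P (Y n) \x nu n.+1]_z h z)%E.
  apply: eq_measure_integral => A mA _; apply/esym.
  apply: product_measure_unique mA => B1 B2 mB1 mB2.
  exact: (V1_independence Y_ind n mB1 mB2).
rewrite fubini_tonelli1// (Beta_law_integral (Y_beta n))//.
- exact: measurable_fun_fubini_tonelli_F.
- by move=> x; apply: integral_ge0.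
Qed.

(** Size-biasing is available since the test function vanishes below [1/s]. The substituted
    integrand is that of [ltprob_rec] for [p = s - 1] and [q = 1], which puts the first stick
    back. *)
Lemma integral_V1_dickman_test s : 1 < s ->
  (\int[P]_w (dickman_test alpha theta s (V 0 w))%:E =
   ((s - 1) `^ theta * ltprob (nu 0) (s - 1) 1)%:E)%E.
Proof.
move=> s1; have s0 : 0 < s by rewrite (lt_trans _ s1).
have mt := measurable_dickman_test alpha theta s.
transitivity (lawI nu 0 (dickman_test alpha theta s)).
  rewrite /lawI ge0_integral_distribution//; first exact/measurable_EFinP.
  by move=> v; rewrite lee_fin dickman_test_ge0.
rewrite (@lawI_biasI _ _ _ _ _ alpha_lt1 b_gt0 bS C_gt0 k1 nu01 nu_rec _ _ s^-1)//.
- have b0 : b 0 = theta + alpha by rewrite /b mul1r.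
  rewrite /biasI /stick_density b0.
  rewrite (size_biased_substitution alpha theta (nu 1) s1 (ltW (C_gt0 0))).
  have s10 : 0 <= s - 1 by rewrite subr_ge0 ltW.
  rewrite EFinM (ltprob_rec nu_rec 0 1 s10) -ge0_integralZl_EFin//.
  - by apply: eq_integral => z _; rewrite -EFinM /stick_density b0.
  - move=> z _; rewrite lee_fin; apply: mulr_ge0; last exact: ltprob_ge0.
    by apply: mulr_ge0 => //; exact: stick_density_ge0.
  - apply/measurable_EFinP; apply: measurable_funM; last by apply: measurable_ltprob; mfun.
    by apply: measurable_funM; [apply: measurable_stick_density; mfun|mfun].
  - exact: powR_ge0.
- by move=> v; exact: dickman_test_ge0.
- by rewrite invr_gt0.
- move=> v vs; rewrite /dickman_test (_ : (1 <= s * v)%R = false) ?mul0r//.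
  by apply/negbTE; rewrite -ltNge mulrC -ltr_pdivlMr// mul1r.
Qed.

Let W w : R := (V 0 w)^-1.

Let mW : measurable_fun setT W.
Proof. by apply: measurable_fun_inv; exact: mV. Qed.

HB.instance Definition _ := isMeasurableFun.Build _ _ _ _ W mW.

Let V_gt0 w : ~ N w -> 0 < V 0 w.
Proof.
by move=> /NN Y01; apply: (@V1_gt0 _ _ (fun i => Y (0 + i)%N)) => i; exact: Y01.
Qed.

(** Since [V 0 > 0] almost surely, [t * V 0 < 1] means [t < 1 / V 0] for every real [t], negative
    ones included. *)
Let rhoE t : rho P (fun i => Y i : T -> R) t = 1 - fine (cdf (W : {RV P >-> R}) t).
Proof.
have mVt : measurable [set w | t * V 0 w < 1].
  rewrite -[X in measurable X]setTI.
  have : measurable_fun setT (fun w => t * V 0 w < 1).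
    by apply: measurable_fun_ltr => //; apply: measurable_funM => //; exact: mV.
  by move=> /(_ measurableT [set true] I).
have mWt : measurable (W @^-1` `]-oo, t]).
  by rewrite -[X in measurable X]setTI; exact: mW.
have PE : P [set w | t * V 0 w < 1] = P (~` (W @^-1` `]-oo, t])).
  have mC := measurableC mWt.
  have iE (A : set T) : measurable A -> P A = (\int[P]_w (\1_A w)%:E)%E.
    by move=> mA; rewrite integral_indic// setIT.
  rewrite !iE//; apply: integral_off_N => //.
  - by apply/measurable_EFinP; exact: measurable_indic.
  - by apply/measurable_EFinP; exact: measurable_indic.
  - move=> w /V_gt0 V0; rewrite !indicE; congr (_%:R)%:E; congr nat_of_bool.
    apply/idP/idP; rewrite !inE/= in_itv/= /W.
      by rewrite -ltr_pdivlMr// mul1r => h; apply/negP; rewrite -ltNge.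
    by move=> /negP; rewrite -ltNge => h; rewrite -ltr_pdivlMr// mul1r.
rewrite /rho -[X in fine X]/(P [set w | t * V 0 w < 1]) PE.
by rewrite probability_setC// fineB ?fin_num_measure.
Qed.

Let nrho t := - rho P (fun i => Y i : T -> R) t.

(** This selects the branch of [cumul_of] that really uses [- rho]; the function is a distribution
    function minus 1. *)
Let nrho_cumulative : nondecreasing nrho /\ right_continuous nrho.
Proof.
split.
  move=> x y xy; rewrite /nrho !rhoE lerN2 lerD2l lerN2.
  by apply: fine_le; rewrite ?fin_num_measure//; exact: cdf_nondecreasing.
have -> : nrho = (fun t => fine (cdf (W : {RV P >-> R}) t) - 1).
  by apply/funext => t; rewrite /nrho rhoE opprB.
move=> x; apply: cvgB; last exact: cvg_cst.
apply: fine_cvg; rewrite fineK ?fin_num_measure//.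
exact: cdf_right_continuous.
Qed.

Let cumulE : cumul_of nrho = nrho :> (R -> R).
Proof. by rewrite /cumul_of; case: pselect. Qed.

(** A Stieltjes measure is determined by its values on the intervals []u, v]], and there both sides
    are the increment of the distribution function of [W]. *)
Let LS_law (A : set (measurableTypeR R)) : measurable A ->
  LS_measure nrho A = P (W @^-1` A).
Proof.
pose W1 : T -> measurableTypeR R := W.
have mW1 : measurable_fun setT W1 by exact: mW.
pose Q : {measure set (measurableTypeR R) -> \bar R} :=
  measure_function_pushforward__canonical__measure_function_Measure P mW1.
apply: (@lebesgue_stieltjes_measure_unique _ _ Q) => I [[u v]/= _ <-].
rewrite /lebesgue_stieltjes_measure /measure_extension/=.
rewrite measurable_mu_extE/=; last exact: is_ocitv.
have [uv | vu] := leP u v; last first.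
  by rewrite set_itv_ge ?wlength0 ?measure0// bnd_simp -leNgt ltW.
rewrite wlength_itv_bnd// cumulE /nrho !rhoE.
rewrite (_ : - _ - _ = fine (cdf (W : {RV P >-> R}) v) - fine (cdf (W : {RV P >-> R}) u)); last ring.
rewrite EFinB !fineK ?fin_num_measure// /cdf.
rewrite -[RHS]/(distribution P (W : {RV P >-> R}) `]u, v]%classic).
have -> : `]u, v]%classic = `]-oo, v] `\` `]-oo, u] :> set R.
  by rewrite -[RHS]setCK setCD setCitvl setUC -[LHS]setCK setCitv.
rewrite measureD ?setIidr//; first exact: subset_itvl.
by rewrite -ge0_fin_numE// fin_num_measure.
Qed.

Lemma V1_dickman_equation s : 1 < s ->
  ((powR (s - 1) theta * rho P (fun i => Y i : T -> R) (s - 1))%:E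
   + LS_integral_noninc (rho P (fun i => Y i : T -> R)) `](s - 1)%R, s]
       (fun t => (powR (s - t) (- alpha) * powR t theta)%R%:E) = 0)%E.
Proof.
move=> s1; have s0 : 0 < s by rewrite (lt_trans _ s1).
pose D : set (measurableTypeR R) := `](s - 1), s]%classic.
pose g (t : R) : \bar R := (powR (s - t) (- alpha) * powR t theta)%:E.
pose W1 : T -> measurableTypeR R := W.
have mW1 : measurable_fun setT W1 by exact: mW.
have mD : measurable D by exact: measurable_itv.
have mg : measurable_fun setT (g : measurableTypeR R -> _).
  by apply/measurable_EFinP; mfun.
have g0 t : (0 <= g t)%E by rewrite lee_fin mulr_ge0 ?powR_ge0.
rewrite /LS_integral_noninc.
have -> : (\int[LS_measure nrho]_(t in D) g t =
    \int[P]_w (dickman_test alpha theta s (V 0 w))%:E)%E.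
  transitivity (\int[pushforward P W1]_(t in D) g t)%E.
    by apply: eq_measure_integral => A mA _; exact: LS_law.
  rewrite ge0_integral_pushforward//; last exact: measurable_funTS.
  have mWD : measurable (W1 @^-1` D).
    by rewrite -[X in measurable X]setTI; exact: mW1.
  rewrite integral_mkcond; apply: integral_off_N.
  - apply/(measurable_restrictT (g \o W1)) => //; apply: measurable_funTS.
    exact: measurableT_comp.
  - apply/measurable_EFinP.
    by apply: (measurableT_comp (measurable_dickman_test alpha theta s)); exact: mV.
  - by move=> w; apply: erestrict_ge0 => x _; exact: g0.
  - by move=> w; rewrite lee_fin dickman_test_ge0.
  - move=> w /V_gt0 V0; rewrite /patch /dickman_test.
    (* The domain of integration, pulled back by [W = 1 / V 0], becomes the two indicators of
       [dickman_test]. *)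
    have -> : (w \in W1 @^-1` D) = ((s - 1) * V 0 w < 1) && (1 <= s * V 0 w).
      have -> : (w \in W1 @^-1` D) = (s - 1 < W w <= s).
        by apply/idP/idP; rewrite inE /D/= in_itv.
      by rewrite /W -ltr_pdivlMr// mul1r -ler_pdivrMr// mul1r.
    case: (_ < _); case: (_ <= _); rewrite ?(mulr0, mul0r, mul1r)//=.
rewrite integral_V1_dickman_test// -EFinN -EFinD.
by rewrite -[ltprob _ _ _]/(rho P (fun i => Y i : T -> R) (s - 1)) subrr.
Qed.

End poisson_dirichlet.

Theorem theorem4p2 (R : realType) (d : measure_display) (T : measurableType d)
    (P : probability T R) (Y : nat -> {RV P >-> R}) (alpha theta : R) :
  0 <= alpha -> alpha < 1 -> - alpha < theta ->
  mutually_independent P (fun i => Y i : T -> R) ->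
  (forall i : nat,
     has_Beta_law P (Y i) (1 - alpha) (theta + i.+1%:R * alpha)) ->
  forall s : R, 1 < s ->
  ((powR (s - 1) theta * rho P (fun i => Y i : T -> R) (s - 1))%:E
   + LS_integral_noninc (rho P (fun i => Y i : T -> R)) `](s - 1)%R, s]
       (fun t => (powR (s - t) (- alpha) * powR t theta)%R%:E) = 0)%E.
Proof.
move=> alpha0 alpha1 theta0 indY betaY s s1.
exact: V1_dickman_equation alpha0 alpha1 theta0 indY betaY s s1.
Qed.
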